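(* Let $k=k_0(T)$ with $k_0$ a finite field of characteristic $p$, let $f(X)\in k_0[X]$ be a monic separable additive polynomial of degree $p^n$ with $\mathcal{G}_f\subseteq k_0$, and let $K=k(y)$ be a geometric elementary abelian $p$-extension of $k$ of degree $p^n$ given by an equation $f(y)=u$ in reduced form. Let $\mathcal{P}\neq\mathcal{P}_\infty$ be a prime divisor of $k$ of degree $m$ that is not ramified in $K/k$, let $P(T)\in k_0[T]$ be the monic irreducible polynomial associated to $\mathcal{P}$, let $k'$ be the splitting field of $P(T)$ over $k_0$ and let $\nu\in k'$ be a root of $P(T)$. Then $\mathcal{P}$ decomposes fully in $K/k$ if and only if for every hyperplane $\mathcal{H}$ of $\mathcal{G}_f$ $$u(\nu)\frac{1}{f_{\mathcal{H}}(\varepsilon_{\mathcal{H}})^p}\in\wp(k'),$$ and $\mathcal{P}$ has inertia degree $p$ in $K/k$ if and only if there exists a hyperplane $\mathcal{H}$ of $\mathcal{G}_f$ such that $$u(\nu)\frac{1}{f_{\mathcal{H}}(\varepsilon_{\mathcal{H}})^p}\notin\wp(k').$$ Equivalently, if condition $( * )$ (given in the context) holds, then $\mathcal{P}$ decomposes fully in $K/k$ if and only if $u(\nu)\in f(k')$.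
   Context: $f$ is additive if $f(x+y)=f(x)+f(y)$ for all $x,y\in\bar k$; $\mathcal{G}_f$ is its set of roots, an $n$-dimensional $\mathbb{F}_p$-vector space. $\mathcal{P}_\infty$ is the pole of $T$. The Artin--Schreier operator is $\wp(c)=c^p-c$, and for $a\neq 0$, $\wp_a(c)=c^p-a^{p-1}c$. For a hyperplane (codimension-$1$ $\mathbb{F}_p$-subspace) $\mathcal{H}$ of $\mathcal{G}_f$, $f_{\mathcal{H}}(X)=\prod_{\delta\in\mathcal{H}}(X-\delta)$ and $\varepsilon_{\mathcal{H}}\in\mathcal{G}_f$ is such that $\mathcal{G}_f=\mathcal{H}+\mathbb{F}_p\varepsilon_{\mathcal{H}}$. Reduced form: the equation $f(y)=u$ is in reduced form if $F(X)=f(X)-u\in k[X]$ is irreducible and $u=\sum_{i=1}^r\frac{Q_i(T)}{P_i(T)^{\alpha_i}}+R(T)$, where $P_1,\ldots,P_r$ are distinct monic irreducible polynomials of $k_0[T]$, $Q_i\in k_0[T]$, $\gcd(Q_i,P_i)=1$, $\deg Q_i<\deg P_i^{\alpha_i}$, $\alpha_i=\lambda_ip^{m_i}>0$ with $0\leq m_i<n$, $\gcd(\lambda_i,p)=1$, and $R(T)\in k_0[T]$ satisfies: if $R\notin k_0$ then $\deg R=\lambda_0p^{m_0}>0$ with $\gcd(\lambda_0,p)=1$, $0\leq m_0<n$; if $R\in k_0$ then $R=0$ or $R\notin f(k_0)$. The finite ramified primes are exactly $P_1,\ldots,P_r$, so $u(\nu)$ is defined. Condition $( * )$: fix an $\mathbb{F}_p$-basis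 $\{\varepsilon_1,\ldots,\varepsilon_n\}$ of $\mathcal{G}_f$, let $\mathcal{H}_i$ be the $\mathbb{F}_p$-span of $\{\varepsilon_j\mid j\neq i\}$, $f_i=f_{\mathcal{H}_i}$ and $a_i=f_i(\varepsilon_i)\neq 0$; then $( * )$ is $\bigcap_{i=1}^n\operatorname{im}\wp_{a_i}=\operatorname{im}f$, the images being those of the maps $\wp_{a_i},f\colon k'\to k'$. *)

(* Defs.v *)
From HB Require Import structures.
From mathcomp Require Import all_boot all_order all_fingroup all_algebra.
From mathcomp Require Import all_solvable all_field.
From mathcomp Require Import mathcomp_extra boolp classical_sets functions.
From mathcomp Require Import cardinality.

Set Implicit Arguments.
Unset Strict Implicit.
Unset Printing Implicit Defensive.

Import GRing.Theory.
Local Open Scope ring_scope.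
Local Open Scope classical_set_scope.

(* A prime divisor of a function field L / k0 is given by its valuation ring,
   a subset O of L.  No discreteness is required: every nontrivial valuation
   ring of a function field in one variable is discrete. *)
Section PrimeDivisors.
Variable L : fieldType.
Implicit Types O : set L.

(* As 0^-1 = 0, the last clause says nothing about x = 0. *)
Definition valuation_ring O : Prop :=
  [/\ O 1, forall x y, O x -> O y -> O (x - y),
      forall x y, O x -> O y -> O (x * y) & forall x, O x \/ O x^-1].

(* cst is the embedding of the field of constants. *)
Definition prime_divisor (k0 : fieldType) (cst : k0 -> L) O : Prop :=
  [/\ valuation_ring O, forall c, O (cst c) & O <> setT].

Definition max_ideal O : set L := [set x | O x /\ (x = 0 \/ ~ O x^-1)].

Definition uniformizer O (t : L) : Prop :=
  t != 0 /\ max_ideal O = [set x * t | x in O].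

End PrimeDivisors.

Section Extension.
Variables (F L : fieldType) (i : F -> L).
Implicit Types (O : set F) (Q : set L).

Definition lies_over O Q : Prop := i @^-1` Q = O.

(* v_Q (i s) = e for a uniformizer s of O: up to a unit of Q, i s is the
   e-th power of a uniformizer of Q. *)
Definition ramification_index O Q (e : nat) : Prop :=
  exists s t, [/\ uniformizer O s, uniformizer Q t,
                  Q (i s / t ^+ e) & Q (t ^+ e / i s)].

(* The residue field of Q has dimension d over that of O: the classes of
   b_0, ..., b_{d-1} form a basis.  The case O = setT, whose residue field is
   F itself, gives the degree of a prime divisor over its constants. *)
Definition residue_degree O Q (d : nat) : Prop :=
  exists b : 'I_d -> L,
    [/\ forall j, Q (b j),
        forall a : 'I_d -> F, (forall j, O (a j)) ->
          max_ideal Q (\sum_j i (a j) * b j) -> forall j, max_ideal O (a j)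
      & forall x, Q x -> exists2 a : 'I_d -> F, forall j, O (a j)
          & max_ideal Q (x - \sum_j i (a j) * b j)].

End Extension.

Section RationalFunctions.
Variable k0 : fieldType.
Local Notation k := {fraction {poly k0}}.

Definition ratC (c : k0) : k := tofrac c%:P.

Definition adic_ring (P : {poly k0}) : set k :=
  [set x | exists a b, ~~ (P %| b) /\ x = tofrac a / tofrac b].

(* The valuation ring of the pole of the variable T. *)
Definition pole_ring : set k :=
  [set x | exists a b : {poly k0},
     [/\ b != 0, (size a <= size b)%N & x = tofrac a / tofrac b]].

Variable E : fieldExtType k0.

Definition peval (a : {poly k0}) (nu : E) : E := (map_poly (in_alg E) a).[nu].

(* The quotient type yields an arbitrary representative of x, hence the
   reduction to lowest terms before evaluating. *)
Definition rat_eval (x : k) (nu : E) : E :=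
  let r := generic_quotient.repr x in let g := gcdp \n_r \d_r in
  peval (\n_r %/ g) nu / peval (\d_r %/ g) nu.

Lemma rat_evalE (a b : {poly k0}) (nu : E) : peval b nu != 0 ->
  rat_eval (tofrac a / tofrac b) nu = peval a nu / peval b nu.
Proof.
have pevalM c d : peval (c * d) nu = peval c nu * peval d nu.
  by rewrite /peval rmorphM hornerM.
move=> bnu; have b0 : b != 0.
  by apply: contraNneq bnu => ->; rewrite /peval rmorph0 horner0.
rewrite /rat_eval; set x : k := tofrac a / tofrac b.
set r := generic_quotient.repr x.
have d0 : \d_r != 0 by exact: denom_ratioP.
have xE : tofrac \n_r = x * tofrac \d_r.
  have -> : x = \pi_(FracField.type {poly k0})%qT r.
    by rewrite generic_quotient.reprK.
  rewrite -[_ * _]/(FracField.mul _ _) !piE; apply/eqmodP.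
  by rewrite /= /equivf /FracField.mulf !numden_Ratio ?mulr1 ?mul1r ?eqxx
             ?oner_eq0.
have nbE : \n_r * b = a * \d_r.
  apply/eqP; rewrite -tofrac_eq !rmorphM /= xE /x mulrAC mulrVK //.
  by rewrite unitfE tofrac_eq0.
set g := gcdp _ _; have g0 : g != 0 by rewrite gcdp_eq0 negb_and d0 orbT.
have nE : \n_r = \n_r %/ g * g by rewrite divpK // dvdp_gcdl.
have dE : \d_r = \d_r %/ g * g by rewrite divpK // dvdp_gcdr.
have qE : (\n_r %/ g) * b = a * (\d_r %/ g).
  by apply: (mulIf g0); rewrite mulrAC -nE nbE {1}dE mulrA.
have dvdb : \d_r %/ g %| b.
  rewrite -(@Gauss_dvdpr _ _ (\n_r %/ g)) ?qE ?dvdp_mull //.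
  by rewrite coprimep_sym coprimep_div_gcd // d0 orbT.
have dnu : peval (\d_r %/ g) nu != 0.
  by apply: contraNneq bnu => h; rewrite -(divpK dvdb) pevalM h mulr0.
by apply/eqP; rewrite eqr_div // -!pevalM qE.
Qed.

End RationalFunctions.

Section ConstantExtension.
Variables (k0 : fieldType) (K : fieldExtType {fraction {poly k0}}).

Definition constK (c : k0) : K := (ratC c)%:A.

Definition geometric : Prop :=
  forall x : K, algebraicOver constK x -> exists c, x = constK c.

Definition primes_above (O : set {fraction {poly k0}}) : set (set K) :=
  [set Q | prime_divisor constK Q /\ lies_over (in_alg K) O Q].

Definition unramified O : Prop :=
  forall Q, primes_above O Q -> ramification_index (in_alg K) O Q 1.

Definition decomposes_fully O : Prop :=
  (primes_above O #= `I_(\dim {:K}))%card.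

(* For the Galois extensions considered, all primes above O have the same
   residue degree. *)
Definition has_inertia_degree O d : Prop :=
  forall Q, primes_above O Q -> residue_degree (in_alg K) O Q d.

End ConstantExtension.

Section AdditivePolynomials.
Variables (k0 : finFieldType) (p : nat) (pchark0 : p \in [pchar k0]).
Local Notation V := (pPrimeCharType pchark0).
Implicit Types (f : {poly k0}) (H : {vspace V}).

(* k0 as an 'F_p-space is V.  The roots in k0 of an additive polynomial form a
   subspace, which is therefore equal to their span (lemma mem_root_space). *)
Definition root_space f : {vspace V} :=
  <<[seq (x : V) | x <- enum (root f)]>>%VS.

Lemma mem_root_space f (x : k0) :
  (forall y z : k0, f.[y + z] = f.[y] + f.[z]) ->
  ((x : V) \in root_space f) = root f x.
Proof.
move=> fD; have f0 : f.[0] = 0 by apply: (addrI f.[0]); rewrite -fD !addr0.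
apply/idP/idP => [|fx]; last first.
  by apply/memv_span/mapP; exists x; rewrite ?mem_enum.
have fMn (y : k0) m : root f y -> root f (y *+ m).
  move=> /rootP fy; apply/rootP.
  by elim: m => [|m IHm]; rewrite ?f0 // mulrS fD fy IHm addr0.
rewrite /root_space; set s := map _ _ => /(@coord_span _ _ _ (in_tuple s)) ->.
apply: (big_ind (fun y : V => root f (y : k0))).
- exact/rootP.
- move=> y z /rootP fy /rootP fz.
  by apply/rootP; rewrite (fD y z) fy fz addr0.
move=> i _.
have -> (c : 'F_p) (y : V) : c *: y = (y : k0) *+ c.
  exact: (mulr_natl (y : k0)).
apply: fMn; have /mapP[y] : s`_i \in s by rewrite mem_nth.
by rewrite mem_enum => + ->.
Qed.

Definition hyperplane f H : bool :=
  (H <= root_space f)%VS && ((\dim H).+1 == \dim (root_space f)).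

Definition complement_gen f H (eps : k0) : Prop :=
  (eps : V) \in root_space f /\ (H + <[(eps : V)]>)%VS = root_space f.

Definition vanishing_poly H : {poly k0} :=
  \prod_(d : k0 | (d : V) \in H) ('X - d%:P).

Variables (n : nat) (e : n.-tuple V).

Definition span_but (i : 'I_n) : {vspace V} :=
  <<[seq tnth e j | j <- enum 'I_n & j != i]>>%VS.

Definition basis_const (i : 'I_n) : k0 :=
  (vanishing_poly (span_but i)).[tnth e i].

End AdditivePolynomials.

Section ReducedForm.
Variables (k0 : fieldType) (p n : nat).
Local Notation k := {fraction {poly k0}}.

Definition reduced_form (f : {poly k0}) (u : k) : Prop :=
  irreducible_poly (map_poly (@ratC k0) f - u%:P) /\
  exists (r : nat) (P Q : 'I_r -> {poly k0})
         (alpha lambda m : 'I_r -> nat) (R : {poly k0}),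
  [/\ u = (\sum_i tofrac (Q i) / tofrac (P i ^+ alpha i)) + tofrac R,
      injective P,
      forall i, [/\ P i \is monic, irreducible_poly (P i),
                    coprimep (Q i) (P i) &
                    (size (Q i) < size (P i ^+ alpha i))%N],
      forall i, [/\ alpha i = (lambda i * p ^ m i)%N, (0 < alpha i)%N,
                    (m i < n)%N & coprime (lambda i) p]
    & if (1 < size R)%N then
        exists lambda0 m0 : nat,
          [/\ (size R).-1 = (lambda0 * p ^ m0)%N, coprime lambda0 p
             & (m0 < n)%N]
      else R = 0 \/ forall c : k0, R <> f.[c]%:P].

End ReducedForm.

Section ArtinSchreier.
Variables (E : fieldType) (p : nat).

Definition wp (c : E) : E := c ^+ p - c.

Definition wp_at (a c : E) : E := c ^+ p - a ^+ p.-1 * c.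

End ArtinSchreier.

Definition additive_over (k0 L : fieldType) (cst : k0 -> L) (f : {poly k0}) :=
  forall x y : L, (map_poly cst f).[x + y] =
                  (map_poly cst f).[x] + (map_poly cst f).[y].

(* Main.v *)
Require Import Defs.
From HB Require Import structures.
From mathcomp Require Import all_boot all_order all_fingroup all_algebra.
From mathcomp Require Import all_solvable all_field.
From mathcomp Require Import mathcomp_extra boolp classical_sets functions.
From mathcomp Require Import cardinality.

(** Since [u] is regular at [P], the primes of [K] above [P] can be read off the
   reduced equation [f(X) = u(nu)] over the residue field [k'].  Let [Om] be an
   algebraically closed field in which [k'] is the fixed field of a power
   [z |-> z ^+ q] of Frobenius.  A zero [c] of the reduced equation is a point
   [(nu, c)] of the curve [f(X) = u], and the quotients of elements of [k0[T][y]]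
   whose denominator does not vanish at this point form a ring [plane_valring c].
   The reduced equation being separable, this ring is a discrete valuation ring
   with uniformizer [P] ([plane_ker_psi], [local_factor]).  Discrete valuation
   rings are maximal subrings, so every prime above [P] is one of these rings
   ([primes_above_point]); its residue field is [k'(c)].

   As [f] is additive with roots in the constants, the zeros form a coset of the
   space of roots of [f], and Frobenius translates all of them by the same root
   [del] of [f].  If [del = 0], the zeros lie in [k'] and give as many distinct
   primes as [f] has roots, namely [p ^ n], with residue field [k'].  If [del] is
   not zero, [c] and [c + del] are conjugate and give the same prime, so there are
   fewer than [p ^ n] of them, and [k'(c)] has degree [p], the conjugates of [c]
   being the [c + i * del] ([decomposes_fully_shift], [inertia_degree_shift]).

   It remains to decide whether [del = 0].  This holds if and only if [u(nu)] is
   a value of [f] on [k'] ([shift_eq0_image]).  For a hyperplane [H] with polynomial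
   [f_H] and [a = f_H(eps)], one has [f = f_H ^ p - a ^ (p - 1) * f_H]
   ([vanishing_poly_adjoin]), so that [f_H(c) / a] is a solution of the
   Artin-Schreier equation [w ^ p - w = u(nu) / a ^ p].  This equation is solvable
   in [k'] if and only if [f_H(c)] is fixed by Frobenius, that is if [f_H(del) = 0],
   that is if [del] is in [H]; and only [0] is in all hyperplanes
   ([hyperplane_criterion]).

   The regularity of [u] at [P] comes from the reduced form: a pole of [u] at [P]
   has order [lambda * p ^ m] with [m < n] and [lambda] prime to [p], while at an
   unramified prime above [P] that order would be [p ^ n] times the pole order
   of [y] ([pole_ramified]).  This presupposes that some prime lies above [P], which
   Zorn's lemma provides ([extend_to_valring]). *)

Set Implicit Arguments.
Unset Strict Implicit.
Unset Printing Implicit Defensive.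

Import GRing.Theory.
Local Open Scope ring_scope.
Local Open Scope classical_set_scope.

(** * Valuation rings *)

Section ValuationRings.
Variables (L : fieldType) (Q : set L).
Hypothesis vQ : valuation_ring Q.

Lemma valring1 : Q 1. Proof. by case: vQ. Qed.

Lemma valringB x y : Q x -> Q y -> Q (x - y).
Proof. by case: vQ => _ + _ _; apply. Qed.

Lemma valringM x y : Q x -> Q y -> Q (x * y).
Proof. by case: vQ => _ _ + _; apply. Qed.

Lemma valringVor x : Q x \/ Q x^-1. Proof. by case: vQ. Qed.

Lemma valring0 : Q 0.
Proof. by rewrite -(subrr 1); apply: valringB; apply: valring1. Qed.

Lemma valringN x : Q x -> Q (- x).
Proof. by rewrite -[- x]sub0r; apply: valringB; apply: valring0. Qed.

Lemma valringD x y : Q x -> Q y -> Q (x + y).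
Proof. by move=> Qx /valringN Qy; rewrite -[y]opprK; apply: valringB. Qed.

Lemma valringX x j : Q x -> Q (x ^+ j).
Proof.
move=> Qx; elim: j => [|j IHj]; first exact: valring1.
by rewrite exprS; apply: valringM.
Qed.

Lemma valring_sum (I : Type) (r : seq I) (A : pred I) (F : I -> L) :
  (forall i, A i -> Q (F i)) -> Q (\sum_(i <- r | A i) F i).
Proof. by apply: big_ind => //; [exact: valring0 | exact: valringD]. Qed.

Lemma max_ideal_sub x : max_ideal Q x -> Q x. Proof. by case. Qed.

Lemma max_ideal1F : ~ max_ideal Q 1.
Proof.
case=> _ [/eqP|]; first by rewrite oner_eq0.
by rewrite invr1; apply; apply: valring1.
Qed.

Lemma max_ideal0 : max_ideal Q 0.
Proof. by split; [exact: valring0 | left]. Qed.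

Lemma max_idealP x : x != 0 -> ~ Q x^-1 -> max_ideal Q x.
Proof. by move=> x0 nQ; split; [case: (valringVor x) | right]. Qed.

Lemma unit_valring x : Q x -> ~ max_ideal Q x -> x != 0 /\ Q x^-1.
Proof.
move=> Qx nmx; have x0 : x != 0.
  by apply: contra_notN nmx => /eqP->; apply: max_ideal0.
by split=> //; apply: contra_notP nmx; apply: max_idealP.
Qed.

Lemma max_idealV x : x != 0 -> max_ideal Q x -> ~ Q x^-1.
Proof. by move=> x0 [_ []] // /eqP; rewrite (negbTE x0). Qed.

Lemma max_idealM x y : Q x -> max_ideal Q y -> max_ideal Q (x * y).
Proof.
move=> Qx my; have Qy := max_ideal_sub my.
have [->|xy0] := eqVneq (x * y) 0; first exact: max_ideal0.
apply: max_idealP => // Qxy.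
move: xy0; rewrite mulf_eq0 negb_or => /andP[x0 y0].
apply: (max_idealV y0 my).
have -> : y^-1 = x * (x * y)^-1 by rewrite invfM mulrA mulfV ?mul1r.
exact: valringM.
Qed.

Lemma max_idealMr x y : max_ideal Q x -> Q y -> max_ideal Q (x * y).
Proof. by rewrite mulrC => *; apply: max_idealM. Qed.

Lemma max_idealN x : max_ideal Q x -> max_ideal Q (- x).
Proof.
by rewrite -mulN1r; apply: max_idealM; apply: valringN; apply: valring1.
Qed.

(** One of [x / y] and [y / x] lies in [Q], so the sum is a multiple of one of
   its terms. *)
Lemma max_idealD x y : max_ideal Q x -> max_ideal Q y -> max_ideal Q (x + y).
Proof.
wlog Qxy : x y / Q (x / y) => [IH mx my|mx my].
  case: (valringVor (x / y)) => [/IH|]; first exact.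
  by rewrite invf_div addrC => /IH; apply.
have [y0|y0] := eqVneq y 0; first by rewrite y0 addr0.
have -> : x + y = (x / y + 1) * y by rewrite mulrDl mulfVK // mul1r.
by apply: max_idealM => //; apply: valringD => //; apply: valring1.
Qed.

Lemma max_idealB x y : max_ideal Q x -> max_ideal Q y -> max_ideal Q (x - y).
Proof. by move=> mx my; apply: max_idealD => //; apply: max_idealN. Qed.

Lemma max_ideal_sum (I : Type) (r : seq I) (A : pred I) (F : I -> L) :
  (forall i, A i -> max_ideal Q (F i)) -> max_ideal Q (\sum_(i <- r | A i) F i).
Proof. by apply: big_ind => //; [exact: max_ideal0 | exact: max_idealD]. Qed.

(** Dividing by [x ^+ N] turns the lower terms of a monic polynomial into
   multiples of [x^-1], which lies in the maximal ideal as soon as [x] is not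
   integral. *)
Lemma horner_at_pole (g : {poly L}) x :
    g \is monic -> (forall i, Q g`_i) -> ~ Q x ->
  exists2 w, max_ideal Q w & g.[x] = x ^+ (size g).-1 * (1 + w).
Proof.
move=> g_monic Qg nQx; have x0 : x != 0.
  by apply: contra_notN nQx => /eqP->; apply: valring0.
have mx' : max_ideal Q x^-1 by apply: max_idealP; rewrite ?invr_eq0 ?invrK.
have sz : size g = (size g).-1.+1 by rewrite prednK ?size_poly_gt0 ?monic_neq0.
set N := (size g).-1 in sz *.
exists (\sum_(i < N) g`_i * x^-1 ^+ (N - i)).
  apply: max_ideal_sum => i _; apply: max_idealM => //.
  rewrite -[(N - i)%N]prednK ?subn_gt0 // exprS.
  by apply: max_idealMr => //; apply: valringX; apply: max_ideal_sub.
rewrite horner_coef sz big_ord_recr /= mulrDr mulr1 addrC.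
congr (_ + _); first by rewrite -[g`_N]/(lead_coef g) (monicP g_monic) mul1r.
rewrite mulr_sumr; apply: eq_bigr => i _.
have /subnKC/(congr1 (GRing.exp x)) <- : (i <= N)%N by apply: ltnW.
by rewrite mulrCA exprVn exprD mulfK ?expf_neq0.
Qed.

Lemma unit_1D w : max_ideal Q w -> 1 + w != 0 /\ Q (1 + w)^-1.
Proof.
move=> mw; apply: unit_valring.
  by apply: valringD; [exact: valring1 | exact: max_ideal_sub].
move=> m1w; apply: max_ideal1F.
by rewrite -[1](addrK w); apply: max_idealB.
Qed.

(** A pole of [x] would make the value of [g] have a pole at least as high. *)
Lemma valring_integral (g : {poly L}) x :
  g \is monic -> (1 < size g)%N -> (forall i, Q g`_i) -> Q g.[x] -> Q x.
Proof.
move=> g_monic sg Qg Qgx; apply: contrapT => nQx.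
have [w mw gE] := horner_at_pole g_monic Qg nQx.
have [w0 Qw] := unit_1D mw; have x0 : x != 0.
  by apply: contra_notN nQx => /eqP->; apply: valring0.
have Qx' : Q x^-1 by case: (valringVor x).
apply: nQx.
have -> : x = g.[x] * (1 + w)^-1 * x^-1 ^+ (size g).-2.
  rewrite gE mulfK // -[(size g).-1]prednK; last by rewrite -subn1 subn_gt0.
  by rewrite exprS exprVn mulfK ?expf_neq0.
by apply: valringM; [apply: valringM | apply: valringX].
Qed.

End ValuationRings.

(** * Extending a ring to a valuation ring *)

Section Chevalley.
Variables (L : fieldType) (A : set L) (t : L).
Hypotheses (A1 : A 1) (AB : forall x y, A x -> A y -> A (x - y)).
Hypotheses (AM : forall x y, A x -> A y -> A (x * y)).
Hypotheses (At : A t) (AtV : ~ A t^-1).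

Let subring_avoiding (R : set L) :=
  [/\ A `<=` R, forall x y, R x -> R y -> R (x - y),
      forall x y, R x -> R y -> R (x * y) & ~ R t^-1].

Let adjoin (R : set L) x :=
  [set z | exists g : {poly L}, (forall i, R g`_i) /\ z = g.[x]].

Let t0 : t != 0.
Proof.
apply: contra_notN AtV => /eqP->.
by rewrite invr0 -(subrr 1); apply: AB.
Qed.

Section Maximal.
Variable R : set L.
Hypothesis R_ok : subring_avoiding R.
Hypothesis R_max : forall S, subring_avoiding S -> R `<=` S -> S `<=` R.

Let AR : A `<=` R. Proof. by case: R_ok. Qed.
Let R1 : R 1. Proof. exact: AR. Qed.
Let RB x y : R x -> R y -> R (x - y). Proof. by case: R_ok => _ + _ _; apply. Qed.
Let RM x y : R x -> R y -> R (x * y). Proof. by case: R_ok => _ _ + _; apply. Qed.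
Let R0 : R 0. Proof. by rewrite -(subrr 1); apply: RB. Qed.
Let RN x : R x -> R (- x). Proof. by rewrite -[- x]sub0r; apply: RB. Qed.
Let RD x y : R x -> R y -> R (x + y).
Proof. by move=> Rx /RN Ry; rewrite -[y]opprK; apply: RB. Qed.
Let Rsum (I : Type) (r : seq I) (B : pred I) (F : I -> L) :
  (forall i, B i -> R (F i)) -> R (\sum_(i <- r | B i) F i).
Proof. by apply: big_ind. Qed.

Lemma adjoin_inverse x : ~ R x -> adjoin R x t^-1.
Proof.
move=> nRx; apply: contrapT => nt; apply: nRx.
have sub : R `<=` adjoin R x.
  move=> z Rz; exists z%:P; split; last by rewrite hornerC.
  by move=> i; rewrite coefC; case: ifP.
suff /R_max/(_ sub) : subring_avoiding (adjoin R x).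
  apply; exists 'X; split; last by rewrite hornerX.
  by move=> i; rewrite coefX; case: eqP.
split=> //; first by move=> z /AR/sub.
- move=> _ _ [g [Rg ->]] [h [Rh ->]]; exists (g - h); split.
    by move=> i; rewrite coefB; apply: RB.
  by rewrite hornerD hornerN.
move=> _ _ [g [Rg ->]] [h [Rh ->]]; exists (g * h); split.
  by move=> i; rewrite coefM; apply: Rsum => j _; apply: RM.
by rewrite hornerM.
Qed.

(** By maximality it is enough that adjoining the inverse does not produce
   [t^-1]: that would make a power of [1 - t * b] divisible by [t], and so [1] too. *)
Lemma unit_1B b : R b -> R (1 - t * b)^-1.
Proof.
move=> Rb; apply: contrapT => /adjoin_inverse[g [Rg]].
have Rt := AR At; set v := 1 - t * b => tE.
have Rv : R v by apply: RB => //; apply: RM.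
have RX j : R (v ^+ j).
  by elim: j => [|j IHj]; [rewrite expr0 | rewrite exprS; apply: RM].
have v0 : v != 0.
  apply/eqP => v0; case: R_ok => _ _ _; apply; rewrite tE v0 invr0.
  by rewrite horner_coef0.
have [a Ra vE] : exists2 a, R a & v ^+ size g = t * a.
  exists (\sum_(i < size g) g`_i * v ^+ (size g - i)).
    by apply: Rsum => i _; apply: RM.
  apply: (mulfI (x := t^-1)); first by rewrite invr_eq0.
  rewrite mulKf // tE horner_coef mulr_suml; apply: eq_bigr => i _.
  rewrite -mulrA exprVn; congr (_ * _).
  have /subnKC/(congr1 (GRing.exp v)) <- : (i <= size g)%N by apply: ltnW.
  by rewrite exprD mulKf ?expf_neq0.
have [c Rc cE] : exists2 c, R c & v ^+ size g = 1 - t * c.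
  elim: (size g) => [|j [c Rc cE]]; first by exists 0; rewrite ?mulr0 ?subr0.
  exists (c + b * v ^+ j); first by apply: RD => //; apply: RM.
  rewrite exprS [in LHS]/v mulrBl mul1r {1}cE mulrDr opprD addrA.
  by congr (_ - _); rewrite mulrA.
case: R_ok => _ _ _; apply.
have -> : t^-1 = a + c.
  apply: (mulfI t0); rewrite mulfV // mulrDr -vE cE.
  by rewrite subrK.
exact: RD.
Qed.

(** If neither [x] nor [x^-1] were in [R], then [t^-1] would be a polynomial in
   [x] and also one in [x^-1].  Taking both of least degree, the shorter relation
   expresses a power of [x] through lower ones, because [1 - t * b] is a unit, and
   this shortens the longer relation. *)
Lemma maximal_valring : valuation_ring R.
Proof.
split=> // x; apply: contrapT => /not_orP[nRx nRx'].
pose rel z d := exists g : {poly L},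
  [/\ forall i, R g`_i, (size g <= d)%N & t^-1 = g.[z]].
have min_rel z : ~ R z ->
    exists2 d, rel z d & forall d', rel z d' -> (d <= d')%N.
  case/adjoin_inverse => g [Rg E].
  have ex : exists d, `[< rel z d >] by exists (size g); apply/asboolP; exists g.
  case: (ex_minnP ex) => d /asboolP rd dmin.
  by exists d => // d' rd'; apply: dmin; apply/asboolP.
have [r rx rmin] := min_rel _ nRx; have [s sx smin] := min_rel _ nRx'.
wlog le_sr : x r s nRx nRx' rx rmin sx smin / (s <= r)%N.
  move=> IH; case/orP: (leq_total s r); first exact: (IH x r s).
  by apply: (IH x^-1 s r); rewrite ?invrK.
have x0 : x != 0 by apply/eqP => x0; apply: nRx; rewrite x0.
case: sx => h [Rh sh hE]; case: rx => g [Rg sg gE].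
have Rt := AR At; have nt : ~ R t^-1 by case: R_ok.
case: s => [|s] in sh smin le_sr *.
  move: sh; rewrite leqn0 size_poly_eq0 => /eqP h0.
  by case: nt; rewrite hE h0 horner0.
case: r => [//|r] in sg rmin le_sr *.
(* solving the relation for x^-1 makes x ^+ r a combination of lower powers *)
have [c [Rc sc xE]] : exists c : {poly L},
    [/\ forall i, R c`_i, (size c <= r)%N & x ^+ r = t * c.[x]].
  have Rv' := unit_1B (Rh 0%N); set v := 1 - _ in Rv'.
  have v0 : v != 0.
    apply/eqP => /eqP; rewrite subr_eq0 => /eqP E; apply: nt.
    by rewrite -[t^-1]mulr1 E mulKf.
  exists (\sum_(i < s) (v^-1 * h`_i.+1) *: 'X^(r - i.+1)); split.
  - move=> j; rewrite coef_sum; apply: Rsum => i _.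
    by rewrite coefZ coefXn; apply: RM; [apply: RM | case: eqP].
  - apply: (leq_trans (size_sum _ _ _)); apply/bigmax_leqP => i _.
    apply: (leq_trans (size_scale_leq _ _)); rewrite size_polyXn subnSK //.
      exact: leq_subr.
    exact: leq_trans (ltn_ord i) _.
  apply: (mulfI v0); rewrite mulrCA.
  have {1}-> : v = t * (t^-1 - h`_0) by rewrite mulrBr mulfV.
  rewrite -mulrA; congr (_ * _).
  rewrite hE (horner_coef_wide _ sh) big_ord_recl /= expr0 mulr1 addrC addKr.
  rewrite horner_sum mulr_suml mulr_sumr; apply: eq_bigr => i _.
  rewrite hornerZ hornerXn !mulrA mulfV // mul1r -mulrA; congr (_ * _).
  have le_ir : (i.+1 <= r)%N := leq_trans (ltn_ord i) le_sr.
  by rewrite -[in LHS](subnKC le_ir) exprD exprVn mulKf ?expf_neq0.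
suff : (r.+1 <= r)%N by rewrite ltnn.
apply: rmin.
exists (\poly_(i < r) g`_i + (g`_r * t) *: c); split.
- by move=> i; rewrite coefD coefZ coef_poly; apply: RD; [case: ifP | do 2?apply: RM].
- rewrite (leq_trans (size_polyD _ _)) // geq_max size_poly.
  exact: leq_trans (size_scale_leq _ _) sc.
rewrite gE (horner_coef_wide _ sg) big_ord_recr /= hornerD horner_poly hornerZ.
by rewrite xE mulrA.
Qed.

End Maximal.

(** A valuation ring is obtained as a maximal subring not containing [t^-1]. *)
Lemma extend_to_valring :
  exists Q : set L, [/\ valuation_ring Q, A `<=` Q & ~ Q t^-1].
Proof.
(* the empty set is admitted as the union of the empty chain *)
pose C (R : set L) := R = set0 \/ subring_avoiding R.
have [F FC Ftot|R [CR maxR]] := @Zorn_bigcup _ C.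
  have [[R FR R0]|noR] := pselect (exists2 R, F R & R !=set0); last first.
    left; apply/seteqP; split=> // z [R FR Rz].
    by apply: noR; exists R => //; exists z.
  have ok S z : F S -> S z -> subring_avoiding S.
    by move=> /FC[-> //|].
  have cap x y : (\bigcup_(X in F) X) x -> (\bigcup_(X in F) X) y ->
      exists S, [/\ F S, S x & S y].
    move=> [S FS Sx] [S' FS' Sy].
    by case: (Ftot _ _ FS FS') => sub; [exists S' | exists S]; split=> //; apply: sub.
  right; split.
  - case: R0 => z Rz x Ax; exists R => //.
    by case: (ok _ _ FR Rz) => + _ _ _; apply.
  - move=> x y /cap/[apply] -[S [FS Sx Sy]]; exists S => //.
    by case: (ok _ _ FS Sx) => _ + _ _; apply.
  - move=> x y /cap/[apply] -[S [FS Sx Sy]]; exists S => //.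
    by case: (ok _ _ FS Sx) => _ _ + _; apply.
  - by move=> [S FS St]; case: (ok _ _ FS St) => _ _ _; apply.
have AC : subring_avoiding A by split.
have R_ok : subring_avoiding R.
  case: CR => // R0; case: (maxR A); last by right.
  rewrite R0; split; first exact: sub0set.
  by move/(_ 1 A1).
exists R; split; [|by case: R_ok|by case: R_ok].
apply: maximal_valring => // S S_ok sub; apply: contrapT => nsub.
by case: (maxR S); [split | right].
Qed.

End Chevalley.

(** * The local ring of a point *)

Section LocalRing.
Variables (B : comNzRingType) (L Om : fieldType).
Variables (ev : {rmorphism B -> L}) (psi : {rmorphism B -> Om}).
Hypothesis ker_ev : forall g, ev g = 0 -> psi g = 0.

(** A relation rather than a residue map, because [x] comes without a preferred
   fraction; it is functional by [specializes_inj]. *)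
Definition specializes (x : L) (r : Om) : Prop :=
  exists g h, [/\ psi h != 0, x = ev g / ev h & r = psi g / psi h].

Definition local_ring : set L := [set x | exists r, specializes x r].

Lemma ev_neq0 g : psi g != 0 -> ev g != 0.
Proof. by apply: contraNneq => /ker_ev->. Qed.

Lemma specializes_ev g : specializes (ev g) (psi g).
Proof. by exists g, 1; rewrite !rmorph1 !divr1 oner_neq0. Qed.

Lemma specializes0 : specializes 0 0.
Proof. by rewrite -(rmorph0 ev) -(rmorph0 psi); apply: specializes_ev. Qed.

Lemma specializes1 : specializes 1 1.
Proof. by rewrite -(rmorph1 ev) -(rmorph1 psi); apply: specializes_ev. Qed.

Lemma specializesD x y r s :
  specializes x r -> specializes y s -> specializes (x + y) (r + s).
Proof.
move=> [g [h [h0 -> ->]]] [g' [h' [h'0 -> ->]]].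
exists (g * h' + g' * h), (h * h').
by rewrite !rmorphD !rmorphM !addf_div ?mulf_neq0 ?ev_neq0.
Qed.

Lemma specializesM x y r s :
  specializes x r -> specializes y s -> specializes (x * y) (r * s).
Proof.
move=> [g [h [h0 -> ->]]] [g' [h' [h'0 -> ->]]].
by exists (g * g'), (h * h'); rewrite !rmorphM !mulf_div ?mulf_neq0.
Qed.

Lemma specializesN x r : specializes x r -> specializes (- x) (- r).
Proof. by case=> g [h [h0 -> ->]]; exists (- g), h; rewrite !rmorphN !mulNr. Qed.

Lemma specializesB x y r s :
  specializes x r -> specializes y s -> specializes (x - y) (r - s).
Proof. by move=> xr /specializesN; apply: specializesD. Qed.

Lemma specializesV x r : specializes x r -> r != 0 -> specializes x^-1 r^-1.
Proof.
case=> g [h [h0 -> ->]]; rewrite mulf_eq0 negb_or => /andP[g0 _].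
by exists h, g; rewrite !invf_div.
Qed.

Lemma specializes_sum (I : Type) (s : seq I) (F : I -> L) (G : I -> Om) :
  (forall i, specializes (F i) (G i)) ->
  specializes (\sum_(i <- s) F i) (\sum_(i <- s) G i).
Proof.
move=> FG; apply: (big_rec2 specializes); first exact: specializes0.
by move=> i r x _; apply: specializesD.
Qed.

Lemma specializes_inj x r s : specializes x r -> specializes x s -> r = s.
Proof.
move=> [g [h [h0 -> ->]]] [g' [h' [h'0 /eqP + ->]]].
rewrite eqr_div ?ev_neq0 // -!rmorphM -subr_eq0 -rmorphB => /eqP/ker_ev/eqP.
by rewrite rmorphB !rmorphM subr_eq0 => E; apply/eqP; rewrite eqr_div.
Qed.

Variable pi : B.
Hypotheses (ev_pi : ev pi != 0) (psi_pi : psi pi = 0).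
Hypothesis ev_frac : forall x, exists g h, ev h != 0 /\ x = ev g / ev h.
Hypothesis ker_psi : forall g, psi g = 0 ->
  exists s r, psi s != 0 /\ ev (s * g) = ev (pi * r).
Hypothesis ev_dvd : forall g, ev g != 0 ->
  exists h t w, psi w != 0 /\ ev (g * h) = ev (pi ^+ t * w).

(** As long as [psi r] vanishes, a factor [pi] can be split off [r]; a multiple
   of [g] of the form [pi ^+ t * w] bounds how often this happens. *)
Lemma local_order g : ev g != 0 ->
  exists j s w, [/\ psi s != 0, psi w != 0 & ev (s * g) = ev (pi ^+ j * w)].
Proof.
move=> g0; apply: contrapT => no_order.
have split_pi j : exists s r, psi s != 0 /\ ev (s * g) = ev (pi ^+ j * r).
  elim: j => [|j [s [r [s0 E]]]].
    by exists 1, g; rewrite rmorph1 oner_neq0.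
  have [r0|r0] := eqVneq (psi r) 0; last by case: no_order; exists j, s, r.
  have [s' [r' [s'0 E']]] := ker_psi r0.
  exists (s' * s), r'; rewrite rmorphM mulf_neq0 //; split=> //.
  move: E E'; rewrite !rmorphM !rmorphXn /= => E E'.
  by rewrite -mulrA E mulrCA E' mulrA exprSr.
have [h [t [w [w0 hE]]]] := ev_dvd g0.
have [s [r [s0 E]]] := split_pi t.+1.
have /ker_ev/eqP : ev (s * w - pi * (r * h)) = 0.
  apply/eqP; rewrite rmorphB subr_eq0; apply/eqP.
  apply: (mulfI (x := ev (pi ^+ t))); first by rewrite rmorphXn expf_neq0.
  move: hE E; rewrite !rmorphM !rmorphXn /= => hE E.
  by rewrite mulrCA -hE [LHS]mulrA E exprSr !mulrA.
by rewrite rmorphB !rmorphM psi_pi mul0r subr0 mulf_eq0 (negbTE s0) (negbTE w0).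
Qed.

Lemma local_factor x : x != 0 -> exists j z r,
  [/\ specializes z r, r != 0 & x = ev pi ^+ j * z \/ x = z / ev pi ^+ j].
Proof.
have [g [h [h0 ->]]] := ev_frac x.
rewrite mulf_eq0 negb_or => /andP[g0 _].
have [i [s [w [s0 w0 gE]]]] := local_order g0.
have [j [s' [w' [s'0 w'0 hE]]]] := local_order h0.
pose z := (ev w / ev s) / (ev w' / ev s').
pose r := (psi w / psi s) / (psi w' / psi s').
have zr : specializes z r.
  have frac a b : psi b != 0 -> specializes (ev a / ev b) (psi a / psi b).
    move=> b0; apply: specializesM (specializes_ev a) _.
    exact: specializesV (specializes_ev b) b0.
  apply: specializesM (frac _ _ s0) (specializesV (frac _ _ s'0) _).
  by rewrite mulf_neq0 ?invr_eq0.
have r0 : r != 0 by rewrite !mulf_neq0 ?invr_eq0 ?mulf_neq0 ?invr_eq0.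
have E : ev g / ev h = ev pi ^+ i / ev pi ^+ j * z.
  have -> : ev g = ev pi ^+ i * (ev w / ev s).
    apply: (mulfI (ev_neq0 s0)).
    rewrite -rmorphM gE rmorphM rmorphXn mulrCA mulrC [_ * (_ / _)]mulrC.
    by rewrite mulfVK ?ev_neq0 // mulrC.
  have -> : ev h = ev pi ^+ j * (ev w' / ev s').
    apply: (mulfI (ev_neq0 s'0)).
    rewrite -rmorphM hE rmorphM rmorphXn mulrCA mulrC [_ * (_ / _)]mulrC.
    by rewrite mulfVK ?ev_neq0 // mulrC.
  by rewrite -mulf_div.
have [le_ji|/ltnW le_ij] := leqP j i.
  exists (i - j)%N, z, r; split=> //; left; rewrite E.
  by rewrite -[in LHS](subnK le_ji) exprD mulfK ?expf_neq0.
exists (j - i)%N, z, r; split=> //; right; rewrite E mulrC; congr (_ * _).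
by rewrite -[in LHS](subnKC le_ij) exprD invfM mulrA mulfV ?expf_neq0 // mul1r.
Qed.

Lemma local_valring : valuation_ring local_ring.
Proof.
split; first by exists 1; apply: specializes1.
- by move=> x y [r xr] [s ys]; exists (r - s); apply: specializesB.
- by move=> x y [r xr] [s ys]; exists (r * s); apply: specializesM.
move=> x; have [->|x0] := eqVneq x 0; first by left; exists 0; apply: specializes0.
have pi_loc j : specializes (ev pi ^+ j) (psi pi ^+ j).
  by rewrite -!rmorphXn; apply: specializes_ev.
have [j [z [r [zr r0 [->|->]]]]] := local_factor x0.
  by left; exists (psi pi ^+ j * r); apply: specializesM.
right; exists (psi pi ^+ j / r); rewrite invf_div.
by apply: specializesM => //; apply: specializesV.
Qed.

Lemma local_max_ideal x r :
  specializes x r -> (max_ideal local_ring x <-> r = 0).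
Proof.
have vQ := local_valring; move=> xr; split=> [mx|r0].
  apply/eqP; apply: contra_notT (max_ideal1F vQ) => r0.
  have x0 : x != 0.
    apply: contraNneq r0 => x0; apply/eqP/(specializes_inj xr).
    by rewrite x0; apply: specializes0.
  rewrite -(mulVf x0); apply: max_idealM => //.
  by exists r^-1; apply: specializesV.
have [->|x0] := eqVneq x 0; first exact: max_ideal0.
apply: max_idealP => // -[s xs].
have := specializesM xr xs; rewrite mulfV // r0 mul0r => /specializes_inj.
by move/(_ _ specializes1)/esym/eqP; rewrite oner_eq0.
Qed.

Lemma local_proper : ~ local_ring (ev pi)^-1.
Proof.
apply: max_idealV => //.
by apply/(local_max_ideal (specializes_ev pi)).
Qed.

(** [local_ring] is a discrete valuation ring with uniformizer [ev pi], so a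
   strictly larger ring would contain the inverse of [ev pi]. *)
Lemma local_maximal (Q : set L) :
    valuation_ring Q -> max_ideal Q (ev pi) ->
    (forall g, psi g != 0 -> Q (ev g)^-1) -> (forall g, Q (ev g)) ->
  Q = local_ring.
Proof.
move=> vQ mpi QV Qev; have sub : local_ring `<=` Q.
  by move=> _ [_ [g [h [h0 -> _]]]]; apply: valringM => //; apply: QV.
apply/seteqP; split=> // x Qx.
have [->|x0] := eqVneq x 0; first by exists 0; apply: specializes0.
have [j [z [r [zr r0 xE]]]] := local_factor x0.
have pi_loc i : specializes (ev pi ^+ i) (psi pi ^+ i).
  by rewrite -!rmorphXn; apply: specializes_ev.
case: xE => xE; first by rewrite xE; exists (psi pi ^+ j * r); apply: specializesM.
case: j => [|j] in xE.
  by exists r; rewrite xE expr0 divr1.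
case: (max_idealV ev_pi mpi).
have z0 : z != 0 by apply: contraNneq x0 => z0; rewrite xE z0 mul0r.
have -> : (ev pi)^-1 = x * z^-1 * ev pi ^+ j.
  by rewrite xE exprS invfM mulrCA -!mulrA [X in _ * X]mulrCA mulVKf ?mulVf ?expf_neq0 ?mulr1.
apply: valringM => //; last by apply: valringX => //; apply: max_ideal_sub.
by apply: valringM => //; apply: sub; exists r^-1; apply: specializesV.
Qed.

End LocalRing.

(** * Points of the curve f(X) = u *)

Lemma fraction_ratio (R : idomainType) (x : {fraction R}) :
  exists a b : R, b != 0 /\ x = tofrac a / tofrac b.
Proof.
pose r := generic_quotient.repr x; exists \n_r, \d_r.
have d0 : \d_r != 0 by exact: denom_ratioP.
split=> //; have -> : tofrac \n_r = x * tofrac \d_r.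
  have -> : x = \pi_(FracField.type R)%qT r.
    by rewrite generic_quotient.reprK.
  rewrite -[_ * _]/(FracField.mul _ _) !piE; apply/eqmodP.
  by rewrite /= /equivf /FracField.mulf !numden_Ratio ?mulr1 ?mul1r ?eqxx ?oner_eq0.
by rewrite mulfK // tofrac_eq0.
Qed.

Lemma tofrac_injective (R : idomainType) : injective (@tofrac R).
Proof. by move=> a b /eqP; rewrite tofrac_eq => /eqP. Qed.

Lemma common_denominator (R : idomainType) (r : {poly {fraction R}}) :
  exists (d : R) (g : {poly R}), d != 0 /\ tofrac d *: r = map_poly (@tofrac R) g.
Proof.
elim/poly_ind: r => [|r x [d [g [d0 E]]]].
  by exists 1, 0; rewrite oner_neq0 rmorph0 scaler0.
have [a [b [b0 ->]]] := fraction_ratio x.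
exists (b * d), (b%:P * g * 'X + (d * a)%:P); split; first by rewrite mulf_neq0.
rewrite rmorphD !rmorphM /= map_polyX !map_polyC /= -E scalerDr.
congr (_ + _); first by rewrite -!mul_polyC rmorphM /= !mulrA.
rewrite -mul_polyC -!polyCM; congr (_%:P).
have cancel (F : fieldType) (v w z : F) : v != 0 -> v * w * (z / v) = w * z.
  by move=> v0; rewrite [v * w]mulrC mulrACA mulfV // mulr1.
by apply: cancel; rewrite tofrac_eq0.
Qed.

Lemma dvdp_multiplicity (F : fieldType) (P d : {poly F}) :
    irreducible_poly P -> d != 0 ->
  exists t w, ~~ (P %| w) /\ d = P ^+ t * w.
Proof.
move=> [sP _]; have [m] := ubnP (size d); elim: m d => // m IHm d /ltnSE le_d d0.
have [Pd|nPd] := boolP (P %| d); last by exists 0%N, d; rewrite expr0 mul1r.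
have dE := divpK Pd; have q0 : d %/ P != 0.
  by apply: contraNneq d0 => q0; rewrite -dE q0 mul0r.
case: (IHm _ _ q0) => [|t [w [nPw qE]]].
  rewrite (leq_trans _ le_d) // size_divp -?size_poly_gt0 ?(ltnW sP) //.
  by rewrite ltn_subrL size_poly_gt0 d0 -subn1 subn_gt0 sP.
by exists t.+1, w; split=> //; rewrite -dE qE exprSr mulrAC.
Qed.

Section Point.
Variables (k0 : fieldType) (K : fieldExtType {fraction {poly k0}}) (y : K).
Variables (E : fieldType) (rho : {rmorphism {poly k0} -> E}).
Variables (Om : closedFieldType) (j : {rmorphism E -> Om}).
Variables (f P U D : {poly k0}).
Hypotheses (P_irr : irreducible_poly P) (rho_ker : forall a, (rho a == 0) = (P %| a)).
Hypotheses (rho_onto : forall e, exists a, rho a = e).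
Hypotheses (f_monic : f \is monic) (D_unit : ~~ (P %| D)).
Hypothesis f_size : (1 < size f)%N.
Let k := {fraction {poly k0}}.
Let tau : {rmorphism {poly k0} -> K} := (in_alg K \o @tofrac {poly k0})%FUN.
Hypothesis y_free : forall r : {poly k}, (size r < size f)%N ->
  (map_poly (in_alg K) r).[y] = 0 -> r = 0.
Hypothesis y_gen : forall x : K, exists r : {poly k}, x = (map_poly (in_alg K) r).[y].
Hypothesis y_root : (map_poly (@constK k0 K) f).[y] = (tofrac U / tofrac D)%:A.

(** The generic point [(T, y)] of the curve. *)
Definition plane_ev : {rmorphism {poly {poly k0}} -> K} :=
  (horner_eval y \o map_poly tau)%FUN.

(** The point [(nu, c)], where [nu] is the image of [T] under [rho]. *)
Definition plane_point (c : Om) : {rmorphism {poly {poly k0}} -> Om} :=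
  (horner_eval c \o map_poly j \o map_poly rho)%FUN.

(** The equation [f(X) = U / D], cleared of denominators. *)
Definition curve : {poly {poly k0}} := D%:P * map_poly polyC f - U%:P.

Definition reduced_curve : {poly E} :=
  map_poly (rho \o polyC) f - (rho U / rho D)%:P.

Hypothesis reduced_sep : separable_poly reduced_curve.

Let rhoD : rho D != 0. Proof. by rewrite rho_ker. Qed.
Let rhoP : rho P = 0. Proof. by apply/eqP; rewrite rho_ker. Qed.

Let P0 : P != 0.
Proof. by apply: contraTneq P_irr.1 => ->; rewrite size_poly0. Qed.

Let D0 : D != 0.
Proof. by apply: contraNneq D_unit => ->; rewrite dvdp0. Qed.

Let f0 : f != 0. Proof. by rewrite -size_poly_gt0 (ltnW f_size). Qed.

Lemma plane_evC a : plane_ev a%:P = (tofrac a)%:A.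
Proof. by rewrite /= map_polyC /horner_eval hornerC. Qed.

Lemma plane_evC_eq0 a : (plane_ev a%:P == 0) = (a == 0).
Proof. by rewrite plane_evC scaler_eq0 oner_eq0 orbF tofrac_eq0. Qed.

Lemma plane_evX : plane_ev 'X = y.
Proof. by rewrite /= map_polyX /horner_eval hornerX. Qed.

Lemma plane_pointC c a : plane_point c a%:P = j (rho a).
Proof. by rewrite /= !map_polyC /horner_eval hornerC. Qed.

Lemma plane_pointX c : plane_point c 'X = c.
Proof. by rewrite /= !map_polyX /horner_eval hornerX. Qed.

Lemma plane_ev_curve : plane_ev curve = 0.
Proof.
rewrite rmorphB rmorphM !plane_evC.
have -> : plane_ev (map_poly polyC f) = (map_poly (@constK k0 K) f).[y].
  by rewrite /= -map_poly_comp.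
by rewrite y_root -(rmorphM (in_alg K)) mulrC mulfVK ?tofrac_eq0 // subrr.
Qed.

Lemma map_curve : map_poly rho curve = (rho D)%:P * reduced_curve.
Proof.
rewrite rmorphB rmorphM /= !map_polyC /= -map_poly_comp mulrBr -polyCM.
by rewrite mulrC [rho D * _]mulrC mulfVK // mulrC.
Qed.

Lemma size_reduced_curve : size reduced_curve = size f.
Proof.
have sf : size (map_poly (rho \o polyC) f) = size f by rewrite size_map_poly.
by rewrite size_polyDl sf // size_polyN (leq_ltn_trans (size_polyC_leq1 _)).
Qed.

Lemma lift_poly (g : {poly E}) : exists h, map_poly rho h = g.
Proof.
elim/poly_ind: g => [|g e [h <-]]; first by exists 0; rewrite rmorph0.
have [a <-] := rho_onto e; exists (h * 'X + a%:P).
by rewrite rmorphD rmorphM /= map_polyX map_polyC.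
Qed.

Lemma map_rho_eq0 h : map_poly rho h = 0 -> exists r, h = P%:P * r.
Proof.
move=> h0; exists (map_poly (fun a => a %/ P) h); apply/polyP => i.
rewrite coefCM coef_map_id0 ?div0p // mulrC divpK // -rho_ker.
by rewrite -coef_map h0 coef0.
Qed.

Section Root.
Variable c : Om.
Hypothesis c_root : root (map_poly j reduced_curve) c.

Let psi := plane_point c.

Lemma plane_point_curve : psi curve = 0.
Proof.
rewrite /psi /= map_curve rmorphM /horner_eval hornerM.
by rewrite (rootP c_root) mulr0.
Qed.

(** Division by the equation of the curve leaves a remainder that vanishes at
   the generic point only if it is zero. *)
Lemma plane_ev_ker g : plane_ev g = 0 -> psi g = 0.
Proof.
move=> g0; have lcE : lead_coef curve = D.
  rewrite /curve lead_coefDl; last first.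
    rewrite size_polyN (leq_ltn_trans (size_polyC_leq1 _)) //.
    by rewrite mul_polyC size_scale // size_map_polyC.
  by rewrite mul_polyC lead_coefZ lead_coef_map (monicP f_monic) mulr1.
have szE : size curve = size f.
  rewrite /curve size_polyDl mul_polyC size_scale ?size_map_polyC //.
  by rewrite size_polyN (leq_ltn_trans (size_polyC_leq1 _)).
have curve0 : curve != 0 by rewrite -size_poly_gt0 szE size_poly_gt0.
have E1 := Pdiv.Idomain.divp_eq g curve.
have r0 : (g %% curve) = 0.
  have : map_poly (@tofrac {poly k0}) (g %% curve) = 0.
    apply: y_free.
      rewrite size_map_inj_poly ?rmorph0 //; last exact: tofrac_injective.
      by rewrite -szE ltn_modp.
    have -> : (map_poly (in_alg K) (map_poly (@tofrac {poly k0}) (g %% curve))).[y]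
      = plane_ev (g %% curve) by rewrite -map_poly_comp.
    move/(congr1 plane_ev): E1.
    rewrite -mul_polyC rmorphM g0 mulr0 rmorphD rmorphM plane_ev_curve mulr0.
    by rewrite add0r.
  rewrite -[X in _ = X](map_poly0 (@tofrac {poly k0})).
  by apply: map_inj_poly; [exact: tofrac_injective | exact: rmorph0].
move/(congr1 psi): E1; rewrite r0 addr0 -mul_polyC !rmorphM plane_point_curve mulr0.
move/eqP; rewrite mulf_eq0 plane_pointC lcE rmorphXn fmorph_eq0 expf_eq0.
by rewrite (negbTE rhoD) andbF => /eqP.
Qed.


(** The reduced equation is squarefree, so what is left of it after removing its
   common factors with [g] does not vanish at [c]. *)
Lemma plane_ker_psi g : psi g = 0 ->
  exists s r, psi s != 0 /\ plane_ev (s * g) = plane_ev (P%:P * r).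
Proof.
move=> g0; set G := map_poly rho g; pose d := gcdp G reduced_curve.
have [s sE] := lift_poly (reduced_curve %/ d).
have [q qE] := lift_poly (G %/ d).
have redE : reduced_curve %/ d * d = reduced_curve by rewrite divpK ?dvdp_gcdr.
have s_c : psi (D%:P * s) != 0.
  rewrite rmorphM mulf_neq0 ?plane_pointC ?fmorph_eq0 //.
  rewrite /psi /= sE /horner_eval.
  have /and3P[_ _ cop] : [&& separable_poly (reduced_curve %/ d),
      separable_poly d & coprimep (reduced_curve %/ d) d].
    by rewrite -separable_mul redE.
  have : coprimep (map_poly j d) (map_poly j (reduced_curve %/ d)).
    by rewrite coprimep_map coprimep_sym.
  by move/coprimep_root; apply; rewrite gcdp_map root_gcd c_root andbT; apply/eqP.
have [r rE] : exists r, D%:P * s * g - q * curve = P%:P * r.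
  apply: map_rho_eq0; rewrite rmorphB !rmorphM /= map_curve map_polyC /= sE qE.
  have GE : G %/ d * d = G by rewrite divpK ?dvdp_gcdl.
  have cross (a b v w z : {poly E}) : w * z = a -> v * z = b -> v * a = w * b.
    by move=> <- <-; rewrite mulrCA.
  by rewrite -/G -mulrA (cross _ _ _ _ _ GE redE) mulrCA subrr.
exists (D%:P * s), r; split=> //.
by rewrite -rE rmorphB [plane_ev (q * _)]rmorphM plane_ev_curve mulr0 subr0.
Qed.

End Root.

Lemma plane_ev_frac x :
  exists g d, d != 0 /\ x = plane_ev g / plane_ev d%:P.
Proof.
have [r ->] := y_gen x; have [d [g [d0 E1]]] := common_denominator r.
exists g, d; split=> //; apply: (mulIf (x := plane_ev d%:P)).
  by rewrite plane_evC_eq0.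
rewrite mulfVK ?plane_evC_eq0 // plane_evC.
have -> : plane_ev g = (map_poly (in_alg K) (map_poly (@tofrac {poly k0}) g)).[y].
  by rewrite -map_poly_comp.
by rewrite -E1 map_polyZ hornerZ mulrC.
Qed.

(** As [K] is generated by [y] as a ring over the rational functions, the inverse
   of [g] has a denominator in [T] alone, which is a multiple of [g]. *)
Lemma plane_ev_dvd g : plane_ev g != 0 -> exists h t w,
  ~~ (P %| w) /\ plane_ev (g * h) = plane_ev ((P%:P) ^+ t * w%:P).
Proof.
move=> g0; have [h [d [d0 E1]]] := plane_ev_frac (plane_ev g)^-1.
have [t [w [Pw dE]]] := dvdp_multiplicity P_irr d0.
exists h, t, w; split=> //; rewrite -rmorphXn -rmorphM -dE rmorphM.
have -> : plane_ev h = plane_ev d%:P / plane_ev g.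
  by rewrite mulrC E1 mulfVK ?plane_evC_eq0.
by rewrite mulrC mulfVK.
Qed.

Definition plane_valring c := local_ring plane_ev (plane_point c).

Section Prime.
Variable c : Om.
Hypothesis c_root : root (map_poly j reduced_curve) c.

Let ev_pi : plane_ev P%:P != 0. Proof. by rewrite plane_evC_eq0. Qed.
Let psi_pi : plane_point c P%:P = 0.
Proof. by rewrite plane_pointC rhoP rmorph0. Qed.
Let frac x : exists g h, plane_ev h != 0 /\ x = plane_ev g / plane_ev h.
Proof.
by have [g [d [d0 ->]]] := plane_ev_frac x; exists g, d%:P; rewrite plane_evC_eq0.
Qed.
Let dvd g : plane_ev g != 0 -> exists h t w,
  plane_point c w != 0 /\ plane_ev (g * h) = plane_ev ((P%:P) ^+ t * w).
Proof.
move=> /plane_ev_dvd[h [t [w [Pw E1]]]]; exists h, t, w%:P.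
by rewrite plane_pointC fmorph_eq0 rho_ker.
Qed.

Lemma plane_valring_valring : valuation_ring (plane_valring c).
Proof.
exact: (local_valring (plane_ev_ker c_root) ev_pi psi_pi frac
  (plane_ker_psi c_root) dvd).
Qed.

Lemma plane_max_ideal x r : specializes plane_ev (plane_point c) x r ->
  (max_ideal (plane_valring c) x <-> r = 0).
Proof.
exact: (local_max_ideal (plane_ev_ker c_root) ev_pi psi_pi frac
  (plane_ker_psi c_root) dvd).
Qed.

Lemma plane_valring_above : primes_above (adic_ring P) (plane_valring c).
Proof.
split; first split; first exact: plane_valring_valring.
- move=> a; exists (plane_point c a%:P%:P); rewrite /constK -plane_evC.
  exact: specializes_ev.
- have := local_proper (plane_ev_ker c_root) ev_pi psi_pi frac
    (plane_ker_psi c_root) dvd.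
  by move=> nP QT; apply: nP; rewrite -/(plane_valring c) QT.
apply/seteqP; split=> x /=; last first.
  move=> [a [b [Pb ->]]]; exists (j (rho a) / j (rho b)).
  exists a%:P, b%:P; split; rewrite ?plane_pointC ?fmorph_eq0 ?rho_ker //.
  by rewrite !plane_evC -!in_algE -fmorph_div.
(* a fraction in lowest terms whose denominator vanishes at nu has no value *)
have [a0 [b0 [b0n ->]]] := fraction_ratio x.
have [->|a0n] := eqVneq a0 0.
  by move=> _; exists 0, 1; rewrite rmorph0 !mul0r dvdp1 neq_ltn P_irr.1 orbT.
pose d := gcdp a0 b0; have d0 : d != 0 by rewrite gcdp_eq0 negb_and a0n.
set a := a0 %/ d; set b := b0 %/ d.
have aE : a0 = a * d by rewrite divpK ?dvdp_gcdl.
have bE : b0 = b * d by rewrite divpK ?dvdp_gcdr.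
have bn : b != 0 by apply: contraNneq b0n => b'0; rewrite bE b'0 mul0r.
have cop : coprimep a b by rewrite coprimep_div_gcd ?a0n.
have -> : tofrac a0 / tofrac b0 = tofrac a / tofrac b :> k.
  by rewrite aE bE !rmorphM /= -mulf_div mulfV ?mulr1 // tofrac_eq0.
move=> Qx; exists a, b; split=> //; apply/negP => Pb.
have Pa : ~~ (P %| a).
  apply/negP => Pa; move: cop => /coprimepP/(_ _ Pa Pb) /eqp_size.
  by rewrite size_poly1 => sP; move: P_irr.1; rewrite sP.
case: Qx => r xr.
have := specializesM xr (specializes_ev plane_ev (plane_point c) b%:P).
rewrite !plane_evC -!in_algE -rmorphM mulfVK ?tofrac_eq0 //.
rewrite plane_pointC; move: Pb; rewrite -rho_ker => /eqP->; rewrite rmorph0 mulr0.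
have := specializes_ev plane_ev (plane_point c) a%:P.
rewrite plane_evC plane_pointC => s1 /(specializes_inj (plane_ev_ker c_root) s1)/eqP.
by rewrite fmorph_eq0 rho_ker (negbTE Pa).
Qed.

End Prime.

(** The equations modulo [P] satisfied on the centre of a prime above [P] are
   the multiples of a single polynomial, by division with remainder; the prime
   is the local ring of any zero of that polynomial. *)
Lemma primes_above_point Q : primes_above (adic_ring P) Q ->
  exists2 c, root (map_poly j reduced_curve) c & Q = plane_valring c.
Proof.
move=> [[vQ Qcst _] lieQ].
have Qk x : adic_ring P x -> Q x%:A by rewrite -lieQ.
have nP1 : ~~ (P %| 1) by rewrite dvdp1 neq_ltn P_irr.1 orbT.
have Qtau a : Q (tofrac a)%:A.
  by apply: Qk; exists a, 1; rewrite rmorph1 divr1.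
have Qy : Q y.
  apply: (valring_integral vQ (g := map_poly (tau \o polyC) f)).
  - by rewrite map_monic.
  - by rewrite size_map_poly.
  - by move=> i; rewrite coef_map; apply: Qcst.
  by apply: (eq_ind_r Q) y_root; apply: Qk; exists U, D.
have Qev g : Q (plane_ev g).
  rewrite /= /horner_eval horner_coef; apply: valring_sum => // i _.
  by apply: valringM => //; [rewrite coef_map; apply: Qtau | apply: valringX].
have mP : max_ideal Q (plane_ev P%:P).
  apply: max_idealP => //; first by rewrite plane_evC_eq0.
  rewrite plane_evC -!in_algE -fmorphV => QP.
  have : adic_ring P (tofrac P)^-1 by rewrite -lieQ.
  case=> a [b [Pb /eqP]]; rewrite -div1r eqr_div ?tofrac_eq0 //; last first.
    by apply: contraNneq Pb => ->; rewrite dvdp0.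
  by rewrite mul1r -rmorphM tofrac_eq => /eqP bE; rewrite bE dvdp_mull in Pb.
pose I g := max_ideal Q (plane_ev g).
have IM g h : I h -> I (g * h).
  by rewrite /I rmorphM => Ih; apply: max_idealM.
have IB g h : I g -> I h -> I (g - h) by rewrite /I rmorphB; apply: max_idealB.
have I_ker h : map_poly rho h = 0 -> I h.
  by move=> /map_rho_eq0[r ->]; rewrite mulrC; apply: IM.
have Icurve : I curve by rewrite /I plane_ev_curve; apply: max_ideal0.
have redf0 : reduced_curve != 0 by rewrite -size_poly_gt0 size_reduced_curve ltnW.
have curve0 : map_poly rho curve != 0.
  by rewrite map_curve mulf_neq0 // polyC_eq0.
pose A n := exists g, [/\ I g, map_poly rho g != 0 & size (map_poly rho g) = n].
have exA : exists n, `[< A n >].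
  by exists (size (map_poly rho curve)); apply/asboolP; exists curve.
case: (ex_minnP exA) => n /asboolP[g [Ig g0 sg]] nmin.
set G := map_poly rho g in g0 sg.
have Gdvd h : I h -> G %| map_poly rho h.
  move=> Ih; have [q qE] := lift_poly (map_poly rho h %/ G).
  have rE : map_poly rho (h - q * g) = map_poly rho h %% G.
    by rewrite rmorphB rmorphM /= qE {1}(divp_eq (map_poly rho h) G) addrC addKr.
  apply: contraT => r0; have : (n <= size (map_poly rho h %% G)%R)%N.
    by apply: nmin; apply/asboolP; exists (h - q * g); rewrite rE; split=> //; apply/IB/IM.
  by rewrite leqNgt -sg ltn_modp g0.
have sG : size G != 1%N.
  apply/negP => /size_poly1P[e e0 GE]; have [a aE] := rho_onto e^-1.
  apply: (max_ideal1F vQ); have I1 : I (a%:P * g - (a%:P * g - 1)).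
    apply: IB; first exact: IM.
    apply: I_ker; rewrite rmorphB rmorphM rmorph1 /= map_polyC /= aE -/G GE.
    by rewrite -polyCM mulVf // subrr.
  by move: I1; rewrite opprB addrC subrK /I rmorph1.
have [c Gc] : exists c, root (map_poly j G) c by apply/closed_rootP; rewrite size_map_poly.
have c_root : root (map_poly j reduced_curve) c.
  have := Gdvd _ Icurve; rewrite map_curve mul_polyC dvdpZr // -(dvdp_map j).
  by move=> /dvdpP[q ->]; rewrite rootM Gc orbT.
exists c => //; apply: (local_maximal (plane_ev_ker c_root) (pi := P%:P)) => //.
- by rewrite plane_evC_eq0.
- by rewrite plane_pointC rhoP rmorph0.
- by move=> x; have [h [d [d0 ->]]] := plane_ev_frac x; exists h, d%:P; rewrite plane_evC_eq0.
- exact: plane_ker_psi.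
- move=> h /plane_ev_dvd[h' [t [w [Pw E1]]]]; exists h', t, w%:P.
  by rewrite plane_pointC fmorph_eq0 rho_ker.
move=> h; apply: contra_neqP => nQh; apply/rootP.
have Ih : I h by apply: contra_notP nQh => nIh; case: (unit_valring vQ (Qev h) nIh).
by have := Gdvd _ Ih; rewrite -(dvdp_map j) => /dvdpP[q qE]; rewrite /= qE rootM Gc orbT.
Qed.

Lemma plane_valring_congr c c' :
  (forall g, (plane_point c g == 0) = (plane_point c' g == 0)) ->
  plane_valring c = plane_valring c'.
Proof.
have sub c1 c2 : (forall g, (plane_point c1 g == 0) = (plane_point c2 g == 0)) ->
    plane_valring c1 `<=` plane_valring c2.
  move=> E1 _ [_ [g [h [h0 -> _]]]].
  by exists (plane_point c2 g / plane_point c2 h); exists g, h; rewrite -E1.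
by move=> E1; apply/seteqP; split; apply: sub.
Qed.

(** A zero [c] in the residue field lifts to a polynomial in [T], and [y] minus
   this lift is in the maximal ideal at [c] only. *)
Lemma plane_valring_inj c c' e :
    root (map_poly j reduced_curve) c -> root (map_poly j reduced_curve) c' ->
    c = j e -> plane_valring c = plane_valring c' -> c = c'.
Proof.
move=> cr cr' cE Q_eq; have [a aE] := rho_onto e.
have sp c2 : specializes plane_ev (plane_point c2) (plane_ev ('X - a%:P)) (c2 - j e).
  have -> : c2 - j e = plane_point c2 ('X - a%:P).
    by rewrite rmorphB plane_pointX plane_pointC aE.
  exact: specializes_ev.
have /(plane_max_ideal cr (sp c)) : c - j e = 0 by rewrite cE subrr.
by rewrite Q_eq => /(plane_max_ideal cr' (sp c'))/eqP; rewrite subr_eq0 cE => /eqP.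
Qed.

Lemma adic_max_ideal a b : ~~ (P %| b) ->
  max_ideal (adic_ring P) (tofrac a / tofrac b) <-> rho a = 0.
Proof.
move=> Pb; have b0 : b != 0 by apply: contraNneq Pb => ->; rewrite dvdp0.
have [->|a0] := eqVneq a 0.
  rewrite !rmorph0 mul0r; split=> // _; split; last by left.
  by exists 0, b; rewrite rmorph0 mul0r.
have x0 : tofrac a / tofrac b != 0 :> k by rewrite mulf_neq0 ?invr_eq0 ?tofrac_eq0.
split=> [|ra0].
  move=> /(max_idealV x0) nO; apply/eqP; apply: contra_notT nO => ra.
  by exists b, a; rewrite -rho_ker ra invf_div.
split; first by exists a, b.
right; rewrite invf_div => -[a' [b' [Pb' /eqP]]].
have b'0 : b' != 0 by apply: contraNneq Pb' => ->; rewrite dvdp0.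
rewrite eqr_div ?tofrac_eq0 // -!rmorphM tofrac_eq => /eqP/(congr1 rho)/eqP.
by rewrite !rmorphM ra0 mulr0 mulf_eq0 !rho_ker (negbTE Pb) (negbTE Pb').
Qed.

Lemma specializes_adic c x : adic_ring P x -> exists e,
  specializes plane_ev (plane_point c) x%:A (j e) /\ (e = 0 -> max_ideal (adic_ring P) x).
Proof.
move=> [a [b [Pb ->]]]; exists (rho a / rho b); split.
  exists a%:P, b%:P; rewrite !plane_pointC fmorph_eq0 rho_ker; split=> //.
    by rewrite !plane_evC -!in_algE fmorph_div.
  exact: fmorph_div.
move=> /eqP; rewrite mulf_eq0 invr_eq0 [rho b == 0]rho_ker (negbTE Pb) orbF => /eqP ra.
exact/adic_max_ideal.
Qed.

(** By the freeness hypothesis [gam] is a minimal polynomial of [c], hence coprime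
   to every denominator; residues are therefore polynomials in [c] of degree less
   than [d]. *)
Lemma plane_residue_degree c d (gam : {poly E}) :
    root (map_poly j reduced_curve) c ->
    (forall g : {poly E}, (size g <= d)%N -> root (map_poly j g) c -> g = 0) ->
    size gam = d.+1 -> root (map_poly j gam) c ->
  residue_degree (in_alg K) (adic_ring P) (plane_valring c) d.
Proof.
move=> cr c_free s_gam gam_c.
have spy i : specializes plane_ev (plane_point c) (y ^+ i) (c ^+ i).
  by rewrite -plane_evX -{2}[c]plane_pointX -!rmorphXn; apply: specializes_ev.
exists (fun i : 'I_d => y ^+ i); split.
- by move=> i; exists (c ^+ i).
- move=> a Oa; have /choice[e eE] i := specializes_adic c (Oa i).
  have sp := specializes_sum (plane_ev_ker cr) (index_enum 'I_d)
    (fun i => specializesM (eE i).1 (spy i)).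
  move=> /(plane_max_ideal cr sp) s0 i.
  apply: (eE i).2; pose g := rVpoly (\row_i e i).
  have g0 : g = 0.
    apply: c_free; first exact: size_poly.
    apply/rootP; rewrite -[RHS]s0 (@horner_coef_wide _ d) ?size_map_poly ?size_poly //.
    by apply: eq_bigr => i' _; rewrite coef_map coef_rVpoly_ord mxE.
  by have := coef_rVpoly_ord (\row_i e i) i; rewrite -/g g0 coef0 mxE.
move=> x [_ [g [h [h0 -> _]]]].
set G := map_poly rho g; set H := map_poly rho h.
have cop : coprimep gam H.
  have gam0 : gam != 0 by rewrite -size_poly_gt0 s_gam.
  pose q := gcdp gam H; have gamE : gam %/ q * q = gam by rewrite divpK ?dvdp_gcdl.
  have q0 : q != 0 by rewrite gcdp_eq0 negb_and gam0.
  have eta0 : gam %/ q != 0 by apply: contraNneq gam0 => z0; rewrite -gamE z0 mul0r.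
  have eta_c : root (map_poly j (gam %/ q)) c.
    move: gam_c; rewrite -{1}gamE rmorphM /= rootM => /orP[//|].
    by rewrite /q gcdp_map root_gcd => /andP[_] /rootP Hc; case/eqP: h0.
  have : (d < size (gam %/ q)%R)%N.
    by rewrite ltnNge; apply: contraNN eta0 => /c_free/(_ eta_c)->.
  rewrite /coprimep -/q; move/(congr1 (size \o @polyseq E)): gamE => /=.
  rewrite size_mul // s_gam => sE; move: q0; rewrite -size_poly_gt0 => q0 lt_d.
  rewrite eqn_leq q0 andbT -(leq_add2l (size (gam %/ q)%R)) addn1.
  by rewrite -(prednK (n := _ + _)%N) ?sE ?addn_gt0 ?q0 ?orbT.
have /Bezout_eq1_coprimepP[[v w] /= vw] := cop.
pose kap := (w * G) %% gam.
have sk : (size kap <= d)%N.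
  by rewrite -ltnS -s_gam ltn_modp -size_poly_gt0 s_gam.
have kc : (map_poly j kap).[c] = plane_point c g / plane_point c h.
  have wE : (map_poly j w).[c] * (map_poly j H).[c] = 1.
    rewrite -hornerM -rmorphM.
    have /(congr1 (fun q => (map_poly j q).[c])) := vw.
    by rewrite rmorphD rmorph1 hornerD hornerC rmorphM hornerM (rootP gam_c) mulr0 add0r.
  have modc (q : {poly E}) : (map_poly j (q %% gam)).[c] = (map_poly j q).[c].
    by rewrite {2}(divp_eq q gam) rmorphD rmorphM /= hornerD hornerM (rootP gam_c) mulr0 add0r.
  apply: (mulIf h0); rewrite mulfVK // /plane_point /= /horner_eval -/G -/H.
  by rewrite modc rmorphM hornerM mulrAC wE mul1r.
have /choice[a aE] i := rho_onto kap`_i.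
exists (fun i : 'I_d => tofrac (a i)).
  by move=> i; exists (a i), 1; rewrite rmorph1 divr1 dvdp1 neq_ltn P_irr.1 orbT.
have spx :
  specializes plane_ev (plane_point c) (plane_ev g / plane_ev h) (map_poly j kap).[c].
  by rewrite kc; exists g, h.
have spa (i : 'I_d) :
    specializes plane_ev (plane_point c) (in_alg K (tofrac (a i))) (j kap`_i).
  rewrite -aE -(plane_pointC c) -[X in specializes _ _ X]plane_evC.
  exact: specializes_ev.
have sp := specializesB (plane_ev_ker cr) spx
  (specializes_sum (plane_ev_ker cr) (index_enum 'I_d)
    (fun i => specializesM (spa i) (spy i))).
apply/(plane_max_ideal cr sp)/eqP; rewrite subr_eq0; apply/eqP.
rewrite (@horner_coef_wide _ d) ?size_map_poly //.
by apply: eq_bigr => i' _; rewrite coef_map.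
Qed.

(** The residue field at a zero [c] in [E] is [E] itself, where any two elements
   are linearly dependent. *)
Lemma plane_residue_degree1 c e d :
    root (map_poly j reduced_curve) c -> c = j e ->
    residue_degree (in_alg K) (adic_ring P) (plane_valring c) d ->
  (d <= 1)%N.
Proof.
move=> cr cE [b [Qb b_free _]]; rewrite leqNgt; apply/negP => d_gt1.
have /choice[r rE] i : exists e', specializes plane_ev (plane_point c) (b i) (j e').
  have [_ [g [h [h0 bE _]]]] := Qb i; exists ((map_poly rho g).[e] / (map_poly rho h).[e]).
  by exists g, h; rewrite fmorph_div -!horner_map /= -cE.
have free (A : 'I_d -> {poly k0}) :
    \sum_i rho (A i) * r i = 0 -> forall i, rho (A i) = 0.
  move=> A0 i; have O1 B : adic_ring P (tofrac B).
    by exists B, 1; rewrite rmorph1 divr1 dvdp1 neq_ltn P_irr.1 orbT.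
  have := b_free (fun i => tofrac (A i)) (fun i => O1 (A i)).
  have spA i' :
      specializes plane_ev (plane_point c) (in_alg K (tofrac (A i'))) (j (rho (A i'))).
    rewrite -(plane_pointC c) -[X in specializes _ _ X]plane_evC.
    exact: specializes_ev.
  have sp := specializes_sum (plane_ev_ker cr) (index_enum 'I_d)
    (fun i => specializesM (spA i) (rE i)).
  have : \sum_i j (rho (A i)) * j (r i) = 0.
    by rewrite -[RHS](rmorph0 j) -A0 rmorph_sum; apply: eq_bigr => i' _; rewrite rmorphM.
  move=> /(plane_max_ideal cr sp) mA /(_ mA i) /=.
  rewrite -[tofrac (A i)]divr1 -(rmorph1 (@tofrac {poly k0})) adic_max_ideal //.
  by rewrite dvdp1 neq_ltn P_irr.1 orbT.
(* r i1 * r i0 - r i0 * r i1 = 0 is a nontrivial relation *)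
pose i0 := Ordinal (ltnW d_gt1); pose i1 := Ordinal d_gt1.
have sum2 (A : 'I_d -> E) : (forall i, i != i0 -> i != i1 -> A i = 0) ->
    \sum_i A i = A i0 + A i1.
  move=> A0; rewrite (bigD1 i0) // (bigD1 i1) //= big1 ?addr0 // => i /andP[].
  exact: A0.
have r0 i : r i != 0.
  apply/eqP => ri; pose A i' : {poly k0} := (i' == i)%:R.
  have A0 : \sum_i' rho (A i') * r i' = 0.
    rewrite (bigD1 i) //= ri mulr0 add0r big1 // => i' /negbTE i'n.
    by rewrite /A i'n rmorph0 mul0r.
  by have /eqP := free A A0 i; rewrite /A eqxx rmorph1 oner_eq0.
have [[a0 a0E] [a1 a1E]] := (rho_onto (r i1), rho_onto (- r i0)).
pose A i := if i == i0 then a0 else if i == i1 then a1 else 0.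
have A0 : \sum_i rho (A i) * r i = 0.
  rewrite sum2 /A /= ?eqxx ?a0E ?a1E; first by rewrite mulNr mulrC subrr.
  by move=> i /negbTE-> /negbTE->; rewrite rmorph0 mul0r.
by have /eqP := free A A0 i0; rewrite /A eqxx a0E (negbTE (r0 i1)).
Qed.

End Point.

(** * Poles and ramification *)

(** As [g] is monic with integral coefficients, [y ^+ N] has the same pole as [u],
   of order [al] because [pi] is still a uniformizer of [Q]; that order is [N]
   times the pole order [b] of [y].  No valuation of [Q] is given, so [b] is found
   as the largest exponent for which [t ^+ b] divides [y^-1]. *)
Lemma unramified_pole_order (F L : fieldType) (i : {rmorphism F -> L})
    (O : set F) (Q : set L) (pi u w : F) (y : L) (g : {poly L}) (N al : nat) :
    valuation_ring O -> valuation_ring Q -> lies_over i O Q ->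
    ramification_index i O Q 1 -> uniformizer O pi ->
    g \is monic -> (forall j, Q g`_j) -> size g = N.+1 -> (0 < N)%N ->
    g.[y] = i u -> O w -> O w^-1 -> w != 0 -> u = w / pi ^+ al -> (0 < al)%N ->
  (N %| al)%N.
Proof.
move=> vO vQ lieQ [s [t []]]; rewrite expr1 => -[s0 sE] [t0 tE] Qst Qts [pi0 piE].
move=> g_monic Qg g_size N_gt0 g_root Ow Ow' w0 uE al_gt0.
have mpi : max_ideal O pi by rewrite piE; exists 1; rewrite ?mul1r //; apply: valring1.
have nOpi := max_idealV pi0 mpi.
have Qi x : O x -> Q (i x) by rewrite -lieQ.
have iQ x : Q (i x) -> O x by rewrite -lieQ.
have is0 : i s != 0 by rewrite fmorph_eq0.
have ipi0 : i pi != 0 by rewrite fmorph_eq0.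
have mt : max_ideal Q t by rewrite tE; exists 1; rewrite ?mul1r //; apply: valring1.
have nQt := max_idealV t0 mt; have Qt := max_ideal_sub mt.
have nQtX j : (0 < j)%N -> ~ Q (t ^- j).
  case: j => // j _ QtX; apply: nQt.
  have -> : t^-1 = t ^+ j / t ^+ j.+1 by rewrite exprSr invfM mulrA mulfV ?mul1r ?expf_neq0.
  by apply: valringM => //; apply: valringX.
have Qpit : Q (i pi / t) /\ Q (t / i pi).
  have [x Ox xE] : [set x * s | x in O] pi.
    by rewrite -sE piE; exists 1; rewrite ?mul1r //; apply: valring1.
  have [x' Ox' xE'] : [set x * pi | x in O] s.
    by rewrite -piE sE; exists 1; rewrite ?mul1r //; apply: valring1.
  split.
    have -> : i pi / t = i x * (i s / t) by rewrite -xE rmorphM mulrA.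
    by apply: valringM => //; apply: Qi.
  have -> : t / i pi = (t / i s) * i x'.
    move: is0; rewrite -xE' rmorphM mulf_eq0 negb_or => /andP[x'0 _].
    by rewrite [i x' * _]mulrC invfM mulrA mulfVK.
  by apply: valringM => //; apply: Qi.
have nQy : ~ Q y.
  move=> Qy; have Ou : O u.
    apply: iQ; rewrite -g_root horner_coef; apply: valring_sum => // j _.
    by apply: valringM => //; apply: valringX.
  apply: nOpi.
  have -> : pi^-1 = u * w^-1 * pi ^+ al.-1.
    rewrite uE [w / _ / w]mulrAC mulfV // mul1r -{1}(prednK al_gt0) exprS invfM.
    by rewrite mulfVK ?expf_neq0.
  apply: valringM => //; first exact: valringM.
  by apply: valringX => //; apply: max_ideal_sub.
have y0 : y != 0 by apply: contra_notN nQy => /eqP->; apply: valring0.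
have [om mom] := horner_at_pole vQ g_monic Qg nQy.
rewrite g_root g_size /= => yE.
have [om0 Qom] := unit_1D vQ mom.
have Qom1 : Q (1 + om) by apply: valringD => //; [exact: valring1 | exact: max_ideal_sub].
pose z := y^-1; have z0 : z != 0 by rewrite invr_eq0.
have Qz : Q z by case: (valringVor vQ y).
have iw0 : i w != 0 by rewrite fmorph_eq0.
(* z ^+ N and t ^+ al differ by the unit eps *)
pose eps := (i pi / t) ^+ al * i w^-1 * (1 + om).
have Qeps : Q eps.
  by apply: valringM => //; apply: valringM; [|apply: valringX => //; case: Qpit|apply: Qi].
have Qeps' : Q eps^-1.
  have -> : eps^-1 = (t / i pi) ^+ al * i w * (1 + om)^-1.
    by rewrite /eps !invfM fmorphV invrK -exprVn invf_div.
  by apply: valringM => //; apply: valringM; [|apply: valringX => //; case: Qpit|apply: Qi].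
have eps0 : eps != 0.
  by rewrite /eps !mulf_neq0 ?expf_neq0 ?mulf_neq0 ?invr_eq0 ?fmorph_eq0 ?invr_eq0.
have zE : z ^+ N = t ^+ al * eps.
  have -> : z ^+ N = (1 + om) / i u.
    by rewrite yE invfM mulrC mulfVK // exprVn.
  rewrite /eps !mulrA -exprMn [t * _]mulrC mulfVK // uE fmorph_div rmorphXn fmorphV.
  by rewrite invf_div mulrC.
have vE b : (z / t ^+ b) ^+ N = t ^+ al * eps / t ^+ (b * N).
  by rewrite expr_div_n -exprM zE.
have bound b : Q (z / t ^+ b) -> (b * N <= al)%N.
  move=> Qb; rewrite leqNgt; apply/negP => lt_al.
  apply: (nQtX (b * N - al)%N); first by rewrite subn_gt0.
  have -> : t ^- (b * N - al) = (z / t ^+ b) ^+ N / eps.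
    rewrite vE -{2}(subnK (ltnW lt_al)) exprD invfM.
    by rewrite [RHS]mulrAC mulfK // mulrCA mulfV ?expf_neq0 // mulr1.
  by apply: valringM => //; apply: valringX.
have ex : exists b, `[< Q (z / t ^+ b) >].
  by exists 0%N; apply/asboolP; rewrite expr0 divr1.
have exB b : `[< Q (z / t ^+ b) >] -> (b <= al)%N.
  by move=> /asboolP/bound; apply: leq_trans; rewrite leq_pmulr.
case: (ex_maxnP ex exB) => b /asboolP Qb bmax.
have nmb : ~ max_ideal Q (z / t ^+ b).
  rewrite tE => -[x Qx xE]; suff : (b < b)%N by rewrite ltnn.
  apply: bmax; apply/asboolP.
  by rewrite exprSr invfM mulrA -xE mulfK.
have [v0 Qb'] := unit_valring vQ Qb nmb.
have bE : (b * N)%N = al.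
  apply/eqP; rewrite eqn_leq bound //= leqNgt; apply/negP => lt_al.
  apply: (nQtX (al - b * N)%N); first by rewrite subn_gt0.
  have -> : t ^- (al - b * N) = eps * (z / t ^+ b)^-1 ^+ N.
    have -> : (z / t ^+ b)^-1 ^+ N = (t ^+ (al - b * N) * eps)^-1.
      rewrite exprVn vE -{1}(subnK (ltnW lt_al)) exprD.
      by rewrite mulrAC mulfK ?expf_neq0.
    by rewrite invfM mulrC mulfVK.
  by apply: valringM => //; apply: valringX.
by rewrite -bE dvdn_mull.
Qed.

Section Poles.
Variables (k0 : fieldType) (K : fieldExtType {fraction {poly k0}}).
Variable P : {poly k0}.
Hypothesis P_irr : irreducible_poly P.
Hypothesis O_valring : valuation_ring (adic_ring P).
Let k := {fraction {poly k0}}.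
Let O := adic_ring P.
Let pi : k := tofrac P.

Let P0 : P != 0.
Proof. by apply: contraTneq P_irr.1 => ->; rewrite size_poly0. Qed.

Let pi0 : pi != 0. Proof. by rewrite tofrac_eq0. Qed.

Lemma adic_ring_poly a : O (tofrac a).
Proof.
by exists a, 1; rewrite rmorph1 divr1 dvdp1 neq_ltn P_irr.1 orbT.
Qed.

Lemma adic_ringPV : ~ O pi^-1.
Proof.
case=> a [b [Pb /eqP]]; rewrite -div1r eqr_div ?tofrac_eq0 //; last first.
  by apply: contraNneq Pb => ->; rewrite dvdp0.
by rewrite mul1r -rmorphM tofrac_eq => /eqP bE; rewrite bE dvdp_mull in Pb.
Qed.

Lemma adic_max_idealP : max_ideal O pi.
Proof. exact/max_idealP/adic_ringPV. Qed.

Lemma adic_max_ideal_dvd x : max_ideal O x -> O (x / pi).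
Proof.
move=> mx; have [a [b [Pb xE]]] := max_ideal_sub mx.
have [x0|x0] := eqVneq x 0; first by rewrite x0 mul0r; apply: valring0.
have Pa : P %| a.
  apply: contraT => Pa; case: (max_idealV x0 mx).
  by exists b, a; rewrite xE invf_div.
exists (a %/ P), b; split=> //.
have cancel (F : fieldType) (v v' z : F) : z != 0 -> v * z / v' / z = v / v'.
  by move=> z0; rewrite [_ / v']mulrAC mulfK.
rewrite xE -[in LHS](divpK Pa) rmorphM; apply: cancel.
exact: pi0.
Qed.

Lemma adic_uniformizer : uniformizer O pi.
Proof.
split=> //; apply/seteqP; split=> [x mx|_ [x Ox <-]].
  by exists (x / pi); [exact: adic_max_ideal_dvd | rewrite mulfVK].
exact/max_idealM/adic_max_idealP.
Qed.

(** A valuation ring above the image of [O] contracts to [O] as soon as it misses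
   the inverse of [P]: the inverse of a nonmember of [O] is divisible by [P]. *)
Lemma primes_above_nonempty : exists Q : set K, primes_above O Q.
Proof.
pose i := in_alg K : {rmorphism k -> K}.
have [|||||Q [vQ OQ nQ]] := @extend_to_valring K (i @` O) (i pi).
- by exists 1; rewrite ?rmorph1 //; apply: valring1.
- move=> _ _ [x Ox <-] [x' Ox' <-]; exists (x - x'); first exact: valringB.
  by rewrite rmorphB.
- move=> _ _ [x Ox <-] [x' Ox' <-]; exists (x * x'); first exact: valringM.
  by rewrite rmorphM.
- by exists pi => //; apply: adic_ring_poly.
- by case=> x Ox /eqP; rewrite -fmorphV (inj_eq (fmorph_inj _)) => /eqP xE;
    apply: adic_ringPV; rewrite -xE.
exists Q; split; first split=> //.
- by move=> a; apply: OQ; exists (ratC a) => //; apply: adic_ring_poly.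
- by move=> QT; apply: nQ; rewrite QT.
apply/seteqP; split=> x /= Qx; last by apply: OQ; exists x.
case: (valringVor O_valring x) => // Ox'; apply: contrapT => nOx.
have x0 : x != 0 by apply: contra_notN nOx => /eqP->; apply: valring0.
apply: nQ; have mx' : max_ideal O x^-1 by apply: max_idealP; rewrite ?invr_eq0 ?invrK.
have -> : (i pi)^-1 = i x * i (x^-1 / pi).
  by rewrite -rmorphM mulrA mulfV // mul1r fmorphV.
apply: valringM => //; apply: OQ; exists (x^-1 / pi) => //.
exact: adic_max_ideal_dvd.
Qed.


(** If [u] has a pole of order [lambda * p ^ m], then so has [y ^+ (p ^ n)] at a
   prime above; without ramification that order is a multiple of [p ^ n]. *)
Lemma pole_ramified (f : {poly k0}) (p n : nat) (y : K) (u w : k) lambda m :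
    prime p -> f \is monic -> size f = (p ^ n).+1 ->
    (map_poly (@constK k0 K) f).[y] = u%:A ->
    O w -> O w^-1 -> w != 0 -> u = w / pi ^+ (lambda * p ^ m) ->
    (0 < lambda * p ^ m)%N -> (m < n)%N -> coprime lambda p ->
  ~ unramified K O.
Proof.
move=> p_prime f_monic f_size y_root Ow Ow' w0 uE al_gt0 lt_mn lam_p unr.
have [Q Qabove] := primes_above_nonempty; have ram := unr Q Qabove.
case: Qabove => -[vQ Qcst _] lieQ.
pose cst : {rmorphism k0 -> K} := (in_alg K \o @tofrac {poly k0} \o polyC)%FUN.
have : (p ^ n %| lambda * p ^ m)%N.
  apply: (unramified_pole_order (g := map_poly cst f) (y := y) O_valring vQ lieQ ram
    adic_uniformizer _ _ _ _ _ Ow Ow' w0 uE) => //.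
  - by rewrite map_monic.
  - by move=> j; rewrite coef_map; apply: Qcst.
  - by rewrite size_map_poly.
  - by rewrite expn_gt0 prime_gt0.
rewrite -(subnK (ltnW lt_mn)) expnD dvdn_pmul2r ?expn_gt0 ?prime_gt0 //.
rewrite -(prednK (n := n - m)) ?subn_gt0 // expnS => /(dvdn_trans (dvdn_mulr _ (dvdnn p))).
by move: lam_p; rewrite coprime_sym prime_coprime // => /negbTE->.
Qed.

End Poles.

(** * Additive polynomials with roots in the constants *)

Section Additive.
Variables (k0 : finFieldType) (p : nat) (pchark0 : p \in [pchar k0]).
Local Notation V := (pPrimeCharType pchark0).
Implicit Types (H : {vspace V}) (f : {poly k0}).

Lemma card_subspace H : #|[pred d : k0 | (d : V) \in H]| = (p ^ \dim H)%N.
Proof.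
by have /= := card_vspace H; rewrite card_Fp ?(pcharf_prime pchark0).
Qed.

Lemma vanishing_polyE H :
  vanishing_poly H = \prod_(d <- enum [pred d : k0 | (d : V) \in H]) ('X - d%:P).
Proof. by rewrite big_enum. Qed.

Lemma size_vanishing_poly H : size (vanishing_poly H) = (p ^ \dim H).+1.
Proof. by rewrite vanishing_polyE size_prod_XsubC -cardE card_subspace. Qed.

Lemma monic_vanishing_poly H : vanishing_poly H \is monic.
Proof. by rewrite vanishing_polyE monic_prod_XsubC. Qed.

Lemma root_vanishing_poly H (d : k0) : root (vanishing_poly H) d = ((d : V) \in H).
Proof. by rewrite vanishing_polyE root_prod_XsubC mem_enum. Qed.

Lemma size_monicB (R : nzRingType) (g h : {poly R}) N :
  g \is monic -> h \is monic -> size g = N.+1 -> size h = N.+1 ->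
  (size (g - h)%R <= N)%N.
Proof.
move=> /monicP g1 /monicP h1 sg sh; apply/leq_sizeP => i.
rewrite leq_eqVlt coefB => /orP[/eqP<-|lt_i].
  by move: g1 h1; rewrite /lead_coef sg sh /= => -> ->; rewrite subrr.
by rewrite !nth_default ?subrr ?sg ?sh.
Qed.

Lemma dvdp_monic_eq (F : fieldType) (g h : {poly F}) :
  g \is monic -> h \is monic -> g %| h -> size g = size h -> g = h.
Proof.
by move=> g1 h1 gh sgh; apply/eqP; rewrite -eqp_monic // -dvdp_size_eqp // sgh.
Qed.

Lemma shift_vanishing_poly H (d : k0) (L : fieldType) (cst : {rmorphism k0 -> L}) x :
  (d : V) \in H ->
  (map_poly cst (vanishing_poly H)).[x + cst d] = (map_poly cst (vanishing_poly H)).[x].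
Proof.
move=> Hd; rewrite /vanishing_poly !rmorph_prod !horner_prod /=.
rewrite (reindex_inj (addIr d)) /=; apply: eq_big => [b|b _].
  exact: (rpredDr _ Hd).
by rewrite !map_polyXsubC !hornerXsubC rmorphD opprD addrACA subrr addr0.
Qed.

(** For fixed [x], the difference of the two sides is a polynomial in [z] of
   degree less than the order of [H] that vanishes on [H]. *)
Lemma vanishing_polyD H (L : fieldType) (cst : {rmorphism k0 -> L}) (x z : L) :
  (map_poly cst (vanishing_poly H)).[x + z] =
  (map_poly cst (vanishing_poly H)).[x] + (map_poly cst (vanishing_poly H)).[z].
Proof.
set W := map_poly cst _.
have W1 : W \is monic by rewrite map_monic monic_vanishing_poly.
have sW : size W = (p ^ \dim H).+1 by rewrite size_map_poly size_vanishing_poly.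
have W0 (d : k0) : (d : V) \in H -> W.[cst d] = 0.
  by rewrite -root_vanishing_poly horner_map => /rootP->; rewrite rmorph0.
pose g := W \Po ('X + x%:P) - W - W.[x]%:P.
suff /(congr1 (fun q => q.[z])) : g = 0.
  rewrite !hornerD !hornerN horner_comp !hornerD hornerX !hornerC.
  by move/eqP; rewrite -addrA -opprD subr_eq0 addrC => /eqP->; rewrite addrC.
apply: (roots_geq_poly_eq0 (rs := [seq cst d | d <- enum [pred d : k0 | (d : V) \in H]])).
- apply/allP => _ /mapP[d + ->]; rewrite mem_enum inE => Hd.
  apply/rootP; rewrite !hornerD !hornerN horner_comp !hornerD hornerX !hornerC.
  by rewrite W0 // subr0 addrC [cst d + x]addrC shift_vanishing_poly // addNr.
- by rewrite map_inj_uniq ?enum_uniq //; apply: fmorph_inj.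
rewrite size_map -cardE card_subspace (leq_trans (size_polyD _ _)) //.
have sX : size ('X + x%:P) = 2 by rewrite -[x]opprK polyCN size_XsubC.
have p_pr := pcharf_prime pchark0.
rewrite geq_max size_polyN (leq_trans (size_polyC_leq1 _)) ?expn_gt0 ?prime_gt0 //.
rewrite andbT; apply: size_monicB => //; last by rewrite size_comp_poly2.
have X1 : 'X + x%:P \is monic by rewrite -[x]opprK polyCN monicXsubC.
by rewrite monicE lead_coef_comp ?sX // (monicP W1) (monicP X1) expr1n mulr1.
Qed.

Lemma vanishing_polyB H (L : fieldType) (cst : {rmorphism k0 -> L}) (x z : L) :
  (map_poly cst (vanishing_poly H)).[x - z] =
  (map_poly cst (vanishing_poly H)).[x] - (map_poly cst (vanishing_poly H)).[z].
Proof. by apply/eqP; rewrite eq_sym subr_eq -vanishing_polyD subrK. Qed.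

Lemma vanishing_poly_lin H (d : k0) (i : nat) :
  (vanishing_poly H).[d *+ i] = (vanishing_poly H).[d] *+ i.
Proof.
have WD (x z : k0) : (vanishing_poly H).[x + z] = (vanishing_poly H).[x] + (vanishing_poly H).[z].
  by have := vanishing_polyD H idfun x z; rewrite map_poly_id.
elim: i => [|i IHi]; last by rewrite !mulrS WD IHi.
by rewrite !mulr0n; apply/rootP; rewrite root_vanishing_poly mem0v.
Qed.

(** Both sides are monic of the same degree, and the Artin-Schreier operator on
   the right kills the multiples of the value at [eps], hence the larger space. *)
Lemma vanishing_poly_adjoin H (eps : k0) : (eps : V) \notin H ->
  vanishing_poly (H + <[(eps : V)]>)%VS =
  vanishing_poly H ^+ p - ((vanishing_poly H).[eps] ^+ p.-1) *: vanishing_poly H.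
Proof.
move=> nHeps; set W := vanishing_poly H; set a := W.[eps].
have p_pr := pcharf_prime pchark0; have p_gt1 := prime_gt1 p_pr.
have sWp : size (W ^+ p) = (p * p ^ \dim H).+1.
  have := size_exp W p; rewrite size_vanishing_poly /= mulnC => <-.
  by rewrite prednK // size_poly_gt0 expf_neq0 // monic_neq0 // monic_vanishing_poly.
have lt_s : (size (- (a ^+ p.-1 *: W)) < size (W ^+ p))%N.
  rewrite size_polyN (leq_ltn_trans (size_scale_leq _ _)) // sWp size_vanishing_poly ltnS.
  by rewrite ltn_Pmull // expn_gt0 ltnW.
have dimH : \dim (H + <[(eps : V)]>) = (\dim H).+1.
  have eps0 : (eps : V) != 0 by apply: contraNneq nHeps => ->; rewrite mem0v.
  rewrite dimv_disjoint_sum ?dim_vline ?eps0 ?addn1 //.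
  apply/eqP; rewrite -subv0; apply/subvP => v /memv_capP[Hv /vlineP[b vE]].
  rewrite memv0 vE; have [->|b0] := eqVneq b 0; first by rewrite scale0r.
  by case/negP: nHeps; have := memvZ b^-1 Hv; rewrite vE scalerA mulVf // scale1r.
apply: dvdp_monic_eq.
- exact: monic_vanishing_poly.
- rewrite monicE lead_coefDl // lead_coef_exp.
  by rewrite (monicP (monic_vanishing_poly H)) expr1n.
- rewrite vanishing_polyE; apply: uniq_roots_dvdp; last first.
    by rewrite uniq_rootsE enum_uniq.
  apply/allP => d; rewrite mem_enum inE => /memv_addP[h Hh [v /vlineP[b ->] dE]].
  have bE : b *: (eps : V) = (eps *+ b : k0) by exact: (mulr_natl eps).
  have Wd : W.[d] = a *+ b.
    have := vanishing_polyD H idfun (h : k0) (eps *+ b : k0).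
    rewrite map_poly_id // vanishing_poly_lin -/W -/a => E1.
    have -> : d = h + eps *+ b :> k0 by rewrite -bE.
    by rewrite E1 (rootP (_ : root W h)) ?add0r // root_vanishing_poly.
  apply/rootP; rewrite hornerD hornerN hornerZ horner_exp Wd.
  rewrite -(pFrobenius_autE pchark0) pFrobenius_autMn pFrobenius_autE.
  by rewrite mulrnAr -exprSr prednK ?subrr // ltnW.
by rewrite size_vanishing_poly dimH size_polyDl // sWp expnS.
Qed.

(** Over an algebraic closure [f] is a product of distinct linear factors, each of
   them defined over the constants. *)
Lemma vanishing_root_space f (kbar : closedFieldType) (cst : {rmorphism k0 -> kbar}) :
    f \is monic -> separable_poly f -> additive_over cst f ->
    (forall z, root (map_poly cst f) z -> exists c, z = cst c) ->
  f = vanishing_poly (root_space pchark0 f).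
Proof.
move=> f_monic f_sep f_add f_roots.
have fD (x z : k0) : f.[x + z] = f.[x] + f.[z].
  by apply: (fmorph_inj cst); rewrite rmorphD -!horner_map rmorphD; apply: f_add.
have [r rE] := closed_field_poly_normal (map_poly cst f).
have {rE} : map_poly cst f = \prod_(z <- r) ('X - z%:P).
  by rewrite {1}rE lead_coef_map (monicP f_monic) rmorph1 scale1r.
move=> rE; have r_root z : z \in r -> exists c, z = cst c.
  by move=> rz; apply: f_roots; rewrite rE root_prod_XsubC.
have [s sE] : exists s, r = map cst s.
  elim: r r_root {rE} => [|z r IHr] r_root; first by exists [::].
  have [s ->] : exists s, r = map cst s.
    by apply: IHr => z' rz'; apply: r_root; rewrite inE rz' orbT.
  by have [c ->] := r_root z (mem_head _ _); exists (c :: s).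
have fE : f = \prod_(c <- s) ('X - c%:P).
  apply: (map_poly_inj cst); rewrite rE sE big_map rmorph_prod.
  by apply: eq_bigr => c _; rewrite /= map_polyXsubC.
have s_uniq : uniq s by rewrite -separable_prod_XsubC -fE.
rewrite vanishing_polyE {1}fE; apply: perm_big; apply: uniq_perm => //.
  exact: enum_uniq.
move=> d; rewrite mem_enum [RHS](_ : _ = ((d : V) \in root_space pchark0 f)) //.
by rewrite mem_root_space // fE root_prod_XsubC.
Qed.

Lemma hyperplane_avoiding f (d : k0) :
  (d : V) \in root_space pchark0 f -> d != 0 ->
  exists2 H, hyperplane f H & (d : V) \notin H.
Proof.
move=> fd d0; set R := root_space pchark0 f.
have sub : (<[(d : V)]> <= R)%VS by rewrite -memvE.
exists (R :\: <[(d : V)]>)%VS; last first.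
  apply/negP => Hd; move: d0; rewrite -(memv0 (d : V)) => /negP; apply.
  by rewrite -(capv_diff R <[(d : V)]>) memv_cap Hd memv_line.
rewrite /hyperplane diffvSl /= -[X in _ == X](dimv_cap_compl R <[(d : V)]>).
by rewrite (capv_idPr sub) dim_vline d0 add1n.
Qed.

End Additive.

(** * Frobenius on the roots of f(X) = u(nu) *)

(** With [p ^ l] the order of [E], the fixed points of the power map are the zeros
   of the product of the [X - e] for [e] in [E]. *)
Lemma frobenius_closure (k0 : finFieldType) (p : nat) (E : fieldExtType k0) :
    p \in [pchar k0] ->
  exists (Om : closedFieldType) (j : {rmorphism E -> Om}) (l : nat),
    forall z : Om, z ^+ (p ^ l) = z <-> exists e, z = j e.
Proof.
move=> pk0; pose F : finFieldType := finvect_type E.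
have pF : p \in [pchar F] by exact: (rmorph_pchar (in_alg E)).
have [Om [j _]] := countable_algebraic_closure F.
have [l cardF] : exists l, #|F| = (p ^ l)%N.
  by exists (logn p #|F|); apply: (card_pprimeChar pF).
exists Om, j, l => z; rewrite -cardF; split=> [zE|[e ->]]; last first.
  by rewrite -rmorphXn [e ^+ _](expf_card (e : F)).
have : root (map_poly j ('X^#|F| - 'X)) z.
  by rewrite rmorphB /= map_polyXn map_polyX /root hornerD hornerN hornerXn hornerX zE subrr.
rewrite finField_genPoly rmorph_prod /root horner_prod => /eqP/eqP.
rewrite prodf_seq_eq0 => /hasP[e _ /=]; rewrite map_polyXsubC hornerXsubC subr_eq0.
by move=> /eqP->; exists e.
Qed.

Lemma wp_scale (F : fieldType) (p : nat) (a x : F) : (0 < p)%N -> a != 0 ->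
  (x ^+ p - a ^+ p.-1 * x) / a ^+ p = (x / a) ^+ p - x / a.
Proof.
case: p => // p _ a0; rewrite expr_div_n mulrBl; congr (_ - _).
by rewrite /= [a ^+ p.+1]exprSr invfM mulrACA mulfV ?mul1r // expf_neq0.
Qed.

Section Frobenius.
Variables (k0 : finFieldType) (p : nat) (pchark0 : p \in [pchar k0]).
Local Notation V := (pPrimeCharType pchark0).
Variables (E : fieldType) (kap : {rmorphism k0 -> E}).
Variables (Om : closedFieldType) (j : {rmorphism E -> Om}) (l : nat).
Local Notation q := (p ^ l)%N.
Hypothesis fixP : forall z : Om, z ^+ q = z <-> exists e, z = j e.
Variables (f : {poly k0}) (ub : E).
Let R := root_space pchark0 f.
Hypothesis fE : f = vanishing_poly R.

Let cst : {rmorphism k0 -> Om} := (j \o kap)%FUN.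
Let redf := map_poly kap f - ub%:P.

Let p_pr : prime p := pcharf_prime pchark0.
Let pchOm : p \in [pchar Om]. Proof. exact: (rmorph_pchar cst). Qed.
Let qnat : [pchar Om].-nat q. Proof. by rewrite pnatX pnatE ?pchOm. Qed.

Lemma frobeniusD (x z : Om) : (x + z) ^+ q = x ^+ q + z ^+ q.
Proof. exact: exprDn_pchar. Qed.

Lemma frobeniusB (x z : Om) : (x - z) ^+ q = x ^+ q - z ^+ q.
Proof. by apply/eqP; rewrite eq_sym subr_eq -frobeniusD subrK. Qed.

Lemma frobenius_fixed e : j e ^+ q = j e. Proof. by apply/fixP; exists e. Qed.

Let frobenius_cst d : cst d ^+ q = cst d.
Proof. exact: frobenius_fixed (kap d). Qed.

Lemma frobenius_horner (g : {poly E}) (c : Om) :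
  (map_poly j g).[c ^+ q] = (map_poly j g).[c] ^+ q.
Proof.
elim/poly_ind: g => [|g e IHg].
  by rewrite rmorph0 !horner0 expr0n expn_eq0 (gtn_eqF (prime_gt0 p_pr)).
rewrite rmorphD rmorphM /= map_polyX map_polyC /= !hornerMXaddC.
by rewrite IHg frobeniusD exprMn frobenius_fixed.
Qed.

Lemma frobenius_prime_field (d : Om) : d ^+ p = d -> d ^+ q = d.
Proof. by move=> dE; elim: (l) => [|i IHi] //; rewrite expnSr exprM IHi. Qed.

Let map_cst (g : {poly k0}) : map_poly j (map_poly kap g) = map_poly cst g.
Proof. by rewrite -map_poly_comp. Qed.

Lemma root_reduced c : root (map_poly j redf) c = ((map_poly cst f).[c] == j ub).
Proof.
by rewrite rmorphB /= map_polyC /= map_cst /root hornerD hornerN hornerC subr_eq0.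
Qed.

Lemma root_additive z :
  root (map_poly cst f) z <-> exists2 d : k0, (d : V) \in R & z = cst d.
Proof.
rewrite fE /vanishing_poly rmorph_prod /root horner_prod; split.
  rewrite prodf_seq_eq0 => /hasP[d _ /= /andP[Rd]].
  by rewrite map_polyXsubC hornerXsubC subr_eq0 => /eqP ->; exists d.
case=> d Rd ->; rewrite prodf_seq_eq0; apply/hasP; exists d; first exact: mem_index_enum.
by rewrite /= Rd map_polyXsubC hornerXsubC subrr eqxx.
Qed.

Let fD x z : (map_poly cst f).[x + z] = (map_poly cst f).[x] + (map_poly cst f).[z].
Proof. by rewrite fE vanishing_polyD. Qed.

Let fB x z : (map_poly cst f).[x - z] = (map_poly cst f).[x] - (map_poly cst f).[z].
Proof. by rewrite fE vanishing_polyB. Qed.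

Lemma root_reduced_shift c c' : root (map_poly j redf) c ->
  root (map_poly j redf) c' <-> exists2 d : k0, (d : V) \in R & c' = c + cst d.
Proof.
rewrite !root_reduced => /eqP cE; split=> [/eqP c'E|[d Rd ->]].
  have /root_additive[d Rd dE] : root (map_poly cst f) (c' - c).
    by rewrite /root fB cE c'E subrr.
  by exists d => //; rewrite -dE addrC subrK.
have /rootP d0 : root (map_poly cst f) (cst d) by apply/root_additive; exists d.
by rewrite fD d0 addr0 cE.
Qed.

(** Frobenius fixes the coefficients of the equation, hence permutes its zeros. *)
Lemma frobenius_shift c : root (map_poly j redf) c ->
  exists2 d : k0, (d : V) \in R & c ^+ q = c + cst d.
Proof.
move=> cr; apply/(root_reduced_shift _ cr).
by rewrite /root frobenius_horner (rootP cr) expr0n expn_eq0 (gtn_eqF (prime_gt0 p_pr)).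
Qed.

(** The zeros form a full coset of the roots of [f], which are all distinct. *)
Lemma reduced_separable : separable_poly redf.
Proof.
rewrite -(separable_map j); have f1 : f \is monic by rewrite fE monic_vanishing_poly.
have sf : size f = (p ^ \dim R).+1 by rewrite {1}fE size_vanishing_poly.
have lt_s : (size (- ub%:P) < size (map_poly kap f))%N.
  rewrite size_polyN size_map_poly sf ltnS (leq_trans (size_polyC_leq1 _)) //.
  by rewrite expn_gt0 prime_gt0.
have s_red : size (map_poly j redf) = (p ^ \dim R).+1.
  by rewrite size_map_poly size_polyDl // size_map_poly.
have [c cr] : exists c, root (map_poly j redf) c.
  by apply/closed_rootP; rewrite s_red eqSS -lt0n expn_gt0 prime_gt0.
pose s := [seq c + cst d | d <- enum [pred d : k0 | (d : V) \in R]].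
have s_uniq : uniq s.
  rewrite map_inj_uniq ?enum_uniq // => d d' /addrI.
  exact: (fmorph_inj cst).
suff <- : \prod_(z <- s) ('X - z%:P) = map_poly j redf by rewrite separable_prod_XsubC.
apply: dvdp_monic_eq.
- exact: monic_prod_XsubC.
- by rewrite map_monic monicE lead_coefDl // lead_coef_map (monicP f1) rmorph1.
- apply: uniq_roots_dvdp; last by rewrite uniq_rootsE.
  apply/allP => _ /mapP[d + ->]; rewrite mem_enum inE => Rd.
  by apply/(root_reduced_shift _ cr); exists d.
by rewrite size_prod_XsubC size_map -cardE card_subspace s_red.
Qed.

Section Shift.
Variables (c : Om) (del : k0).
Hypotheses (c_root : root (map_poly j redf) c) (Rdel : (del : V) \in R).
Hypothesis c_frob : c ^+ q = c + cst del.

Lemma shift_eq0P : del = 0 <-> exists e, c = j e.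
Proof.
rewrite -fixP c_frob; split=> [->|]; first by rewrite rmorph0 addr0.
by move=> /eqP; rewrite -subr_eq0 addrAC subrr add0r fmorph_eq0 => /eqP.
Qed.

Lemma shift_eq0_image : del = 0 <-> exists e, (map_poly kap f).[e] = ub.
Proof.
rewrite shift_eq0P; move: (c_root); rewrite root_reduced => /eqP cE; split=> -[e eE].
  by exists e; apply: (fmorph_inj j); rewrite -cE eE -horner_map map_cst.
have er : root (map_poly j redf) (j e).
  by rewrite root_reduced -map_cst horner_map eE.
have [d _ ->] := (root_reduced_shift _ er).1 c_root.
by exists (e + kap d); rewrite rmorphD.
Qed.

(** A point moved by Frobenius has the [p] distinct conjugates
   [c + i * del], all of them zeros of [g]. *)
Lemma shift_free (g : {poly E}) : del != 0 -> (size g <= p)%N ->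
  root (map_poly j g) c -> g = 0.
Proof.
move=> del0 sg gc; pose s := [seq c + cst del *+ i | i <- iota 0 p].
apply: (map_poly_inj j); rewrite rmorph0.
apply: (roots_geq_poly_eq0 (rs := s)); last by rewrite size_map_poly size_map size_iota.
  apply/allP => _ /mapP[i _ ->]; elim: i => [|i IHi]; first by rewrite addr0.
  have -> : c + cst del *+ i.+1 = (c + cst del *+ i) ^+ q.
    have fixi : (cst del *+ i) ^+ q = cst del *+ i by rewrite -rmorphMn frobenius_cst.
    by rewrite frobeniusD c_frob fixi mulrS addrA.
  by rewrite /root frobenius_horner (rootP IHi) expr0n expn_eq0 (gtn_eqF (prime_gt0 p_pr)).
have step i i' : (i <= i' < p)%N -> cst del *+ i = cst del *+ i' -> i = i'.
  move=> /andP[le_ii lt_i'] /eqP; rewrite eq_sym -subr_eq0 -mulrnBr // -mulr_natr mulf_eq0.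
  rewrite fmorph_eq0 (negbTE del0) -(dvdn_pcharf pchOm) /= => dvd.
  apply/eqP; rewrite eqn_leq le_ii -subn_eq0 eqn0Ngt /=; apply/negP => gt0.
  by have := dvdn_leq gt0 dvd; rewrite leqNgt (leq_ltn_trans (leq_subr _ _)).
rewrite map_inj_in_uniq ?iota_uniq // => i i'; rewrite !mem_iota !add0n => lt_i lt_i' /addrI E1.
by case/orP: (leq_total i i') => le; [|apply/esym]; apply: step; rewrite ?le.
Qed.

(** The polynomial of the line spanned by [del] is invariant under translation by
   [del], so its value at [c] is fixed by Frobenius. *)
Lemma shift_equation : del != 0 ->
  exists2 g : {poly E}, size g = p.+1 & root (map_poly j g) c.
Proof.
move=> del0; pose W := vanishing_poly (<[(del : V)]>%VS : {vspace V}).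
have /fixP[e eE] : (map_poly cst W).[c] ^+ q = (map_poly cst W).[c].
  rewrite -map_cst -frobenius_horner c_frob map_cst shift_vanishing_poly //.
  exact: memv_line.
exists (map_poly kap W - e%:P).
  rewrite size_polyDl size_map_poly size_vanishing_poly dim_vline del0 expn1 //.
  by rewrite size_polyN (leq_ltn_trans (size_polyC_leq1 _)) // ltnS prime_gt0.
by rewrite rmorphB /= map_polyC /= map_cst /root hornerD hornerN hornerC eE subrr.
Qed.

Lemma hyperplane_factor (H : {vspace V}) (eps : k0) :
  hyperplane f H -> complement_gen f H eps ->
  (vanishing_poly H).[eps] != 0 /\
  f = vanishing_poly H ^+ p - ((vanishing_poly H).[eps] ^+ p.-1) *: vanishing_poly H.
Proof.
move=> /andP[subH /eqP dimH] [_ genH].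
have nHeps : (eps : V) \notin H.
  apply: contra_eqN dimH; rewrite memvE => /addv_idPl; rewrite -genH => ->.
  by rewrite gtn_eqF.
split; first by rewrite -[_ == 0]/(root _ _) root_vanishing_poly.
by rewrite -vanishing_poly_adjoin // genH.
Qed.

(** For [e] in [E] with [f.[e] = ub], the value at [e] of the hyperplane polynomial,
   rescaled, solves the Artin-Schreier equation. *)
Lemma hyperplane_condition (H : {vspace V}) (eps : k0) :
  hyperplane f H -> complement_gen f H eps ->
  del = 0 -> range (wp p : E -> E) (ub / kap (vanishing_poly H).[eps] ^+ p).
Proof.
move=> hH gH /shift_eq0_image[e eE]; have [a0 fW] := hyperplane_factor hH gH.
set a := (_).[eps] in a0 fW *; have ka0 : kap a != 0 by rewrite fmorph_eq0.
exists ((map_poly kap (vanishing_poly H)).[e] / kap a) => //.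
rewrite /wp -eE fW rmorphB /= map_polyZ rmorphXn /= hornerD hornerN hornerZ horner_exp.
by rewrite rmorphXn -wp_scale // prime_gt0.
Qed.

(** The value [z] of the rescaled hyperplane polynomial at [c] solves the same
   Artin-Schreier equation as [w], so the two differ by an element of the prime
   field and [z] is fixed by Frobenius; the hyperplane polynomial then vanishes
   at [del]. *)
Lemma hyperplane_shift (H : {vspace V}) (eps : k0) :
  hyperplane f H -> complement_gen f H eps ->
  range (wp p : E -> E) (ub / kap (vanishing_poly H).[eps] ^+ p) -> (del : V) \in H.
Proof.
move=> hH gH [w _ wE]; have [a0 fW] := hyperplane_factor hH gH.
set a := (_).[eps] in a0 fW wE *; have ka0 : cst a != 0 by rewrite fmorph_eq0.
pose Wc := (map_poly cst (vanishing_poly H)).[c]; pose z := Wc / cst a.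
have zE : z ^+ p - z = j w ^+ p - j w.
  rewrite -rmorphXn -rmorphB [X in j X]wE fmorph_div.
  move: (c_root); rewrite root_reduced => /eqP <-.
  rewrite fW rmorphB /= map_polyZ !rmorphXn /= hornerD hornerN hornerZ horner_exp.
  by rewrite /z -wp_scale ?prime_gt0 //.
have /frobenius_prime_field : (z - j w) ^+ p = z - j w.
  have := pFrobenius_autB_comm pchOm (mulrC z (j w)); rewrite !pFrobenius_autE => ->.
  by apply/eqP; rewrite subr_eq addrAC -addrA [X in _ == X]addrC -subr_eq zE.
rewrite frobeniusB frobenius_fixed => /addIr zq.
have Wq : Wc ^+ q = Wc.
  have -> : Wc = z * cst a by rewrite mulfVK.
  by rewrite exprMn zq frobenius_cst.
move: Wq; rewrite /Wc -map_cst -frobenius_horner c_frob map_cst vanishing_polyD => /eqP.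
rewrite -subr_eq0 addrAC subrr add0r horner_map fmorph_eq0.
by rewrite -[_ == 0]/(root _ _) root_vanishing_poly.
Qed.

End Shift.

End Frobenius.

(** * Decomposition of a prime *)

Lemma card_range_injective (T : finType) (U : Type) (F : T -> U) :
  (range F #= `I_#|T|)%card <-> injective F.
Proof.
split=> [/pcard_eqP[g]|F_inj]; last first.
  apply: (card_eq_trans (B := [set: T])).
    by apply: inj_card_eq => x x' _ _; apply: F_inj.
  have <- : range (fun x : T => enum_rank x : nat) = `I_#|T|.
    apply/seteqP; split=> [_ [x _ <-]|i lt_i]; first exact: ltn_ord.
    by exists (enum_val (Ordinal lt_i)); rewrite ?enum_valK.
  rewrite card_eq_sym; apply: inj_card_eq => x x' _ _ /ord_inj.
  exact: enum_rank_inj.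
have [gfun ginj gsurj] : set_bij (range F) `I_#|T| g by [].
have lt_g x : (g (F x) < #|T|)%N by apply: gfun; exists x.
pose h x := Ordinal (lt_g x).
have h_onto i : i \in codom h.
  have [_ [x _ <-] gx] := gsurj _ (ltn_ord i).
  by apply/codomP; exists x; apply: val_inj.
have h_inj : injective h.
  apply/injectiveP; rewrite /dinjectiveb; apply/card_uniqP.
  have /eq_card-> : map h (enum T) =i 'I_#|T| by move=> i; rewrite [LHS]h_onto.
  by rewrite card_ord size_map -cardE.
by move=> x x' FE; apply: h_inj; apply: val_inj; rewrite /= FE.
Qed.

Lemma irreducible_coprimep (F : fieldType) (P P' : {poly F}) : irreducible_poly P ->
  irreducible_poly P' -> P \is monic -> P' \is monic -> P != P' -> coprimep P P'.
Proof.
move=> irrP irrP' P1 P'1 neq; apply/coprimepP => d dP dP'.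
apply: contraT; rewrite -size_poly_eq1 => sd; case/negP: neq.
have dP1 := irrP.2 _ sd dP; have dP2 := irrP'.2 _ sd dP'.
by rewrite -eqp_monic //; apply: eqp_trans dP2; rewrite eqp_sym.
Qed.

Lemma irreducible_notdvd_coprimep (F : fieldType) (P g : {poly F}) :
  irreducible_poly P -> ~~ (P %| g) -> coprimep P g.
Proof.
move=> irrP nPg; apply/coprimepP => d dP dg; apply: contraR nPg.
by rewrite -size_poly_eq1 => sd; rewrite -(eqp_dvdl _ (irrP.2 _ sd dP)).
Qed.

(** An extension of finite fields is normal, so adjoining one root of an irreducible
   polynomial splits it. *)
Lemma residue_generated (k0 : finFieldType) (k' : fieldExtType k0) (P : {poly k0})
    (nu : k') :
    irreducible_poly P ->
    splittingFieldFor 1%VS (map_poly (in_alg k') P) {:k'}%VS ->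
    root (map_poly (in_alg k') P) nu ->
  forall e, exists a, peval a nu = e.
Proof.
move=> P_irr [rs P_rs rs_gen] nuP.
pose L := FinSplittingFieldType k0 k'; pose M : {subfield L} := <<1; (nu : L)>>%AS.
have /and3P[_ _ /normalFieldP/(_ nu (memv_adjoin _ _))[r rM mE]] : galois 1%AS M.
  exact/finField_galois/sub1v.
have /polyOver1P[q qE] := minPolyOver 1%AS (nu : L).
have qP : q %= P.
  apply: P_irr.2.
    apply/negP => /eqP sq; have := size_minPoly 1%VS (nu : L).
    by rewrite qE size_map_poly sq.
  rewrite -(dvdp_map (in_alg L)) -qE; apply: minPoly_dvdp => //.
  exact: alg_polyOver.
have full e : (e : L) \in M.
  suff /subvP : ({:k'} <= M)%VS by apply; rewrite memvf.
  rewrite -rs_gen; apply/Fadjoin_seqP; split; first exact: sub1v.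
  move=> z zrs; apply: (allP rM); rewrite -root_prod_XsubC -mE qE.
  rewrite (eqp_root (_ : map_poly (in_alg L) q %= map_poly (in_alg L) P)) ?eqp_map //.
  by rewrite [root _ _](eqp_root P_rs) root_prod_XsubC.
move=> e; have /Fadjoin_polyP[g /polyOver1P[a ->] ->] := full e.
by exists a.
Qed.

Section Decomposition.
Variables (k0 : finFieldType) (p : nat) (pchark0 : p \in [pchar k0]).
Local Notation V := (pPrimeCharType pchark0).
Variables (K : fieldExtType {fraction {poly k0}}) (y : K).
Variables (E : fieldType) (rho : {rmorphism {poly k0} -> E}).
Variables (Om : closedFieldType) (j : {rmorphism E -> Om}) (l : nat).
Hypothesis fixP : forall z : Om, z ^+ (p ^ l) = z <-> exists e, z = j e.
Variables (f P U D : {poly k0}).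
Hypotheses (P_irr : irreducible_poly P) (rho_ker : forall a, (rho a == 0) = (P %| a)).
Hypotheses (rho_onto : forall e, exists a, rho a = e).
Hypothesis (D_unit : ~~ (P %| D)).
Let R := root_space pchark0 f.
Hypothesis fE : f = vanishing_poly R.
Hypothesis y_free : forall r : {poly {fraction {poly k0}}}, (size r < size f)%N ->
  (map_poly (in_alg K) r).[y] = 0 -> r = 0.
Hypothesis y_gen : forall x : K, exists r : {poly {fraction {poly k0}}},
  x = (map_poly (in_alg K) r).[y].
Hypothesis y_root : (map_poly (@constK k0 K) f).[y] = (tofrac U / tofrac D)%:A.
Hypothesis K_dim : (\dim {:K}).+1 = size f.

Let kap : {rmorphism k0 -> E} := (rho \o polyC)%FUN.
Let ub := rho U / rho D.
Let redf := map_poly kap f - ub%:P.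
Let O := adic_ring P.
Let p_pr : prime p := pcharf_prime pchark0.

Let f_monic : f \is monic. Proof. by rewrite fE monic_vanishing_poly. Qed.
Let f_size : (1 < size f)%N.
Proof. by rewrite fE size_vanishing_poly ltnS expn_gt0 prime_gt0. Qed.
Let red_sep : separable_poly redf.
Proof. exact: (reduced_separable kap j ub fE). Qed.

Variables (c : Om) (del : k0).
Hypotheses (c_root : root (map_poly j redf) c) (Rdel : (del : V) \in R).
Hypothesis c_frob : c ^+ (p ^ l) = c + j (kap del).

Let above (d : {d : k0 | (d : V) \in R}) : set K :=
  plane_valring y rho j (c + j (kap (val d))).

Let above_root (d : {d : k0 | (d : V) \in R}) :
  root (map_poly j redf) (c + j (kap (val d))).
Proof. by apply/(root_reduced_shift fE _ c_root); exists (val d); rewrite ?(valP d). Qed.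

Lemma primes_above_range : primes_above O = range above.
Proof.
apply/seteqP; split=> Q.
  move=> /(primes_above_point j P_irr rho_ker rho_onto f_monic D_unit f_size
    y_free y_gen y_root red_sep).
  move=> [c' c'r ->].
  have [d Rd ->] := (root_reduced_shift fE _ c_root).1 c'r.
  by exists (exist _ d Rd).
case=> d _ <-.
exact: (plane_valring_above P_irr rho_ker rho_onto f_monic D_unit f_size
  y_free y_gen y_root red_sep (above_root d)).
Qed.

Let card_roots : #|{: {d : k0 | (d : V) \in R}}| = \dim {:K}.
Proof.
rewrite card_sig (card_subspace R); apply/succn_inj.
by rewrite K_dim {1}fE size_vanishing_poly.
Qed.

(** Frobenius permutes the zeros of the reduced equation by translation by
   [del]; two zeros give the same prime as soon as they are conjugate. *)
Lemma decomposes_fully_shift : decomposes_fully K O <-> del = 0.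
Proof.
rewrite /decomposes_fully -card_roots primes_above_range card_range_injective.
split=> [above_inj|del0 d d' E1].
  pose z : {d : k0 | (d : V) \in R} := exist _ (0 : k0) (mem0v R).
  have /above_inj/(congr1 val) /= : above (exist _ del Rdel) = above z; last exact.
  apply: plane_valring_congr => g; rewrite /= rmorph0 rmorph0 addr0 -c_frob /horner_eval.
  by rewrite (frobenius_horner pchark0 kap fixP) expf_eq0 expn_gt0 prime_gt0.
have [e cE] := (shift_eq0P fixP c_frob).1 del0.
apply: val_inj; apply: (fmorph_inj kap); apply: (fmorph_inj j); apply: (addrI c).
apply: (plane_valring_inj P_irr rho_ker rho_onto f_monic D_unit f_size
  y_free y_gen y_root red_sep (above_root d) (above_root d') (e := e + kap (val d)) _ E1).
by rewrite rmorphD cE.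
Qed.

(** The common residue degree is the degree of [c] over [E]: [1] or [p]. *)
Lemma inertia_degree_shift : has_inertia_degree K O p <-> del <> 0.
Proof.
rewrite /has_inertia_degree primes_above_range; split=> [res_p del0|/eqP del0 _ [d _ <-]].
  have [e cE] := (shift_eq0P fixP c_frob).1 del0.
  pose d0 : {d : k0 | (d : V) \in R} := exist _ del Rdel.
  have := res_p (above d0) (ex_intro2 _ _ d0 I erefl).
  move=> /(plane_residue_degree1 P_irr rho_ker rho_onto f_monic D_unit f_size
    y_free y_gen y_root red_sep (above_root d0) (e := e + kap del)).
  by rewrite rmorphD cE leqNgt prime_gt1 // => /(_ erefl).
have d_frob : (c + j (kap (val d))) ^+ (p ^ l) = (c + j (kap (val d))) + j (kap del).
  rewrite (frobeniusD pchark0 kap j) [c ^+ _]c_frob (frobenius_fixed fixP).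
  exact: addrAC.
have [gam s_gam gam_c] := shift_equation pchark0 fixP d_frob del0.
apply: (plane_residue_degree P_irr rho_ker rho_onto f_monic D_unit f_size
  y_free y_gen y_root red_sep (above_root d) _ s_gam gam_c).
by move=> g; apply: (shift_free pchark0 fixP d_frob del0).
Qed.

(** Each condition puts [del] in its hyperplane, while a nonzero [del] is avoided by
   some hyperplane. *)
Lemma hyperplane_criterion (eps : {vspace V} -> k0) :
    (forall H, hyperplane f H -> complement_gen f H (eps H)) ->
  del = 0 <-> forall H, hyperplane f H ->
    range (wp p : E -> E) (ub / kap (vanishing_poly H).[eps H] ^+ p).
Proof.
move=> epsP; split=> [del0 H hH|cond].
  exact: (hyperplane_condition fixP fE c_root c_frob hH (epsP H hH)).
apply/eqP; apply: contraT => del0.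
have [H hH /negP[]] := hyperplane_avoiding Rdel del0.
exact: (hyperplane_shift fixP fE c_root c_frob hH (epsP H hH) (cond H hH)).
Qed.

End Decomposition.
(** The poles of [u] ramify, so [u] is regular at an unramified prime. *)
Lemma reduced_form_regular (k0 : fieldType) (K : fieldExtType {fraction {poly k0}})
    (P f : {poly k0}) (p n : nat) (y : K) (u : {fraction {poly k0}}) :
    prime p -> P \is monic -> irreducible_poly P -> valuation_ring (adic_ring P) ->
    f \is monic -> size f = (p ^ n).+1 ->
    (map_poly (@constK k0 K) f).[y] = u%:A -> unramified K (adic_ring P) ->
    reduced_form p n f u ->
  adic_ring P u.
Proof.
move=> p_pr P1 P_irr vO f1 sf y_root unr [_ [r [Pi [Qi [al [lam [m [B [uE Pi_inj PiP alP _]]]]]]]]].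
have P0 : P != 0 by rewrite monic_neq0.
have Opoly := adic_ring_poly P_irr.
have coP i : P != Pi i -> coprimep P (Pi i).
  by have [Pi1 Pi_irr _ _] := PiP i; apply: irreducible_coprimep.
have Oterm i : P != Pi i -> adic_ring P (tofrac (Qi i) / tofrac (Pi i ^+ al i)).
  move=> /coP cop; exists (Qi i), (Pi i ^+ al i); split=> //; apply/negP => dvd.
  have /coprimepP/(_ _ (dvdpp P) dvd) := coprimep_expr (al i) cop.
  by move/eqp_size; rewrite size_poly1 => s1; move: P_irr.1; rewrite s1.
have [[i PE]|noP] := pselect (exists i, P = Pi i); last first.
  rewrite uE; apply: valringD => //; apply: valring_sum => // i _; apply: Oterm.
  by apply/eqP => PE; apply: noP; exists i.
(* the other terms of u do not affect its pole at P = Pi i: w below is a unit *)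
have [alE al_gt0 lt_m lam_p] := alP i.
have [_ _ copQ _] := PiP i.
pose w := u * tofrac P ^+ al i.
have pi0 : tofrac P != 0 :> {fraction {poly k0}} by rewrite tofrac_eq0.
have wE : exists2 x, adic_ring P x & w = tofrac (Qi i) + tofrac P ^+ al i * x.
  exists (\sum_(i' | i' != i) tofrac (Qi i') / tofrac (Pi i' ^+ al i') + tofrac B).
    apply: valringD => //; apply: valring_sum => // i' ni; apply: Oterm.
    by apply: contraNneq ni => PE'; apply/eqP/Pi_inj; rewrite -PE -PE'.
  rewrite /w uE (bigD1 i) //= -PE -addrA mulrDl rmorphXn mulfVK ?expf_neq0 //.
  by rewrite [X in _ + X]mulrC.
have [x Ox {}wE] := wE.
have mP := adic_max_idealP P_irr vO.
have mPx : max_ideal (adic_ring P) (tofrac P ^+ al i * x).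
  rewrite -(prednK al_gt0) exprS -mulrA; apply: max_idealMr => //.
  by apply: valringM => //; apply: valringX.
have Ow : adic_ring P w.
  by rewrite wE; apply: valringD => //; apply: max_ideal_sub.
have nmw : ~ max_ideal (adic_ring P) w.
  move=> mw; have mQ : max_ideal (adic_ring P) (tofrac (Qi i)).
    by have := max_idealB vO mw mPx; rewrite wE addrK.
  have [a [b [Pb /eqP]]] := adic_max_ideal_dvd P_irr vO mQ.
  have b0 : b != 0 by apply: contraNneq Pb => ->; rewrite dvdp0.
  rewrite eqr_div ?tofrac_eq0 // -!rmorphM tofrac_eq => /eqP QE.
  have : P %| Qi i * b by rewrite QE dvdp_mull.
  rewrite Gauss_dvdpl; last first.
    by apply: contraT => /negP ncop; case: ncop; apply: irreducible_notdvd_coprimep.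
  move=> PQ; have /coprimepP/(_ _ PQ) := copQ; rewrite -PE => /(_ (dvdpp P))/eqp_size.
  by rewrite size_poly1 => s1; move: P_irr.1; rewrite s1.
have [w0 Ow'] := unit_valring vO Ow nmw.
case: (pole_ramified P_irr vO p_pr f1 sf y_root Ow Ow' w0 (lambda := lam i) (m := m i)) => //.
  rewrite -alE; exact: (esym (mulfK (expf_neq0 _ pi0) u)).
by rewrite -alE.
Qed.

Theorem theorem6p8
  (k0 : finFieldType) (p : nat) (pchark0 : p \in [pchar k0]) (n : nat)
  (kbar : closedFieldType) (iota : {rmorphism {fraction {poly k0}} -> kbar})
  (kbar_algebraic : forall z : kbar, algebraicOver iota z)
  (f : {poly k0}) (f_monic : f \is monic) (f_separable : separable_poly f)
  (f_additive : additive_over (fun c : k0 => iota (ratC c)) f)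
  (f_degree : size f = (p ^ n).+1%N)
  (roots_in_k0 : forall z : kbar,
     root (map_poly (fun c : k0 => iota (ratC c)) f) z ->
     exists c : k0, z = iota (ratC c))
  (K : splittingFieldType {fraction {poly k0}})
  (K_galois : galois 1%AS {:K})
  (K_abelem : (p.-abelem 'Gal({:K}%VS / 1%AS))%g)
  (K_degree : \dim {:K} = (p ^ n)%N)
  (K_geometric : geometric K)
  (u : {fraction {poly k0}}) (y : K)
  (K_gen : <<1; y>>%VS = {:K}%VS)
  (y_root : (map_poly (@constK k0 K) f).[y] = u%:A)
  (u_reduced : reduced_form p n f u)
  (O : set {fraction {poly k0}}) (O_prime : prime_divisor (@ratC k0) O)
  (O_finite : O <> @pole_ring k0)
  (m : nat) (O_degree : residue_degree (@ratC k0) setT O m)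
  (O_unramified : unramified K O)
  (P : {poly k0}) (P_monic : P \is monic) (P_irr : irreducible_poly P)
  (P_O : O = adic_ring P)
  (k' : fieldExtType k0)
  (k'_split : splittingFieldFor 1%VS (map_poly (in_alg k') P) {:k'}%VS)
  (nu : k') (nu_root : root (map_poly (in_alg k') P) nu)
  (eps : {vspace pPrimeCharType pchark0} -> k0)
  (epsP : forall H, hyperplane f H -> complement_gen f H (eps H)) :
  [/\ decomposes_fully K O <->
        (forall H, hyperplane f H ->
           range (wp p : k' -> k')
             (rat_eval u nu / (((vanishing_poly H).[eps H])%:A) ^+ p)),
      has_inertia_degree K O p <->
        (exists H, hyperplane f H /\
           ~ range (wp p : k' -> k')
               (rat_eval u nu / (((vanishing_poly H).[eps H])%:A) ^+ p))
    & forall e : n.-tuple (pPrimeCharType pchark0),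
        basis_of (root_space pchark0 f) e ->
        \bigcap_(i in [set: 'I_n])
          range (wp_at p ((basis_const e i)%:A) : k' -> k')
          = range (peval f : k' -> k') ->
        (decomposes_fully K O <->
           range (peval f : k' -> k') (rat_eval u nu))].
Proof.
have p_pr : prime p := pcharf_prime pchark0.
pose cst : {rmorphism k0 -> kbar} := (iota \o @tofrac {poly k0} \o polyC)%FUN.
have fE : f = vanishing_poly (root_space pchark0 f).
  exact: (vanishing_root_space pchark0 (cst := cst)).
have O_val : valuation_ring (adic_ring P) by rewrite -P_O; case: O_prime.
have [U [D [D_unit uE]]] : adic_ring P u.
  apply: (reduced_form_regular p_pr P_monic P_irr O_val f_monic f_degree y_root
    _ u_reduced).
  by rewrite -P_O.
pose rho : {rmorphism {poly k0} -> k'} := (horner_eval nu \o map_poly (in_alg k'))%FUN.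
have rho_ker a : (rho a == 0) = (P %| a).
  apply/idP/idP => [/rootP a_nu|/dvdpP[b ->]].
    apply: contraT => nPa.
    have /Bezout_eq1_coprimepP[[v w] /= vw] := irreducible_notdvd_coprimep P_irr nPa.
    have := rmorph1 rho; rewrite -vw rmorphD !rmorphM.
    by rewrite [rho P](rootP nu_root) [rho a]a_nu !mulr0 addr0 => /esym/eqP; rewrite oner_eq0.
  by rewrite rmorphM [rho P](rootP nu_root) mulr0.
have rho_onto := residue_generated P_irr k'_split nu_root.
have [Om [j [l fixP]]] := frobenius_closure k' pchark0.
pose kap : {rmorphism k0 -> k'} := (rho \o polyC)%FUN.
have kapE x : kap x = x%:A by rewrite /= map_polyC /horner_eval hornerC.
have deg_y : adjoin_degree 1 y = (p ^ n)%N.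
  by have := dim_Fadjoin 1%AS y; rewrite K_gen K_degree dimv1 muln1.
have y_free (r : {poly {fraction {poly k0}}}) : (size r < size f)%N ->
    (map_poly (in_alg K) r).[y] = 0 -> r = 0.
  move=> lt_r ry; apply: (map_poly_inj (in_alg K)); rewrite rmorph0.
  apply: contraTeq lt_r => r0; rewrite -leqNgt f_degree -deg_y -size_minPoly.
  rewrite -(size_map_poly (in_alg K) r); apply: dvdp_leq => //.
  by apply: minPoly_dvdp; [apply: alg_polyOver | apply/rootP].
have y_gen x : exists r : {poly {fraction {poly k0}}}, x = (map_poly (in_alg K) r).[y].
  have : x \in <<1; y>>%VS by rewrite K_gen memvf.
  by move=> /Fadjoin_polyP[g /polyOver1P[r ->] ->]; exists r.
rewrite uE in y_root.
have K_dim : (\dim {:K}).+1 = size f by rewrite K_degree f_degree.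
pose ub := rho U / rho D.
have [c c_root] : exists c, root (map_poly j (map_poly kap f - ub%:P)) c.
  apply/closed_rootP; rewrite size_map_poly size_polyDl size_map_poly f_degree.
    by rewrite eqSS expn_eq0 (gtn_eqF (prime_gt0 p_pr)).
  by rewrite size_polyN (leq_ltn_trans (size_polyC_leq1 _)) // ltnS expn_gt0 prime_gt0.
have [del Rdel c_frob] := frobenius_shift fixP fE c_root.
have split_del := decomposes_fully_shift fixP P_irr rho_ker rho_onto D_unit fE
  y_free y_gen y_root K_dim c_root Rdel c_frob.
have inert_del := inertia_degree_shift fixP P_irr rho_ker rho_onto D_unit fE
  y_free y_gen y_root c_root Rdel c_frob.
have hyp_del := hyperplane_criterion fixP fE c_root Rdel c_frob epsP.
have eval_u : rat_eval u nu = ub by rewrite uE rat_evalE // -[peval D nu]/(rho D) rho_ker.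
have im_del : del = 0 <-> range (peval f : k' -> k') ub.
  rewrite (shift_eq0_image fixP fE c_root c_frob); split=> [[e eE]|[e _ eE]]; exists e => //.
    by rewrite -eE; congr (_.[e]); apply: eq_map_poly => x; rewrite kapE.
  by rewrite -eE; congr (_.[e]); apply: eq_map_poly => x; rewrite kapE.
have {}hyp_del : del = 0 <-> forall H, hyperplane f H ->
    range (wp p : k' -> k') (ub / (((vanishing_poly H).[eps H])%:A) ^+ p).
  by rewrite hyp_del; split=> cond H hH; have := cond H hH; rewrite kapE.
rewrite eval_u P_O; split.
- by rewrite split_del.
- rewrite inert_del hyp_del -existsNP.
  by split=> [[H /not_implyP]|[H /not_implyP]]; exists H.
- by move=> e _ _; rewrite split_del.
Qed.
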